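(* Let $\eta \geq \frac{2\log(16 n^2 d^2) + 16|\mathcal{E}| d^2}{\min(\Delta, \frac{1}{128})}$ and let $\epsilon^{-1} > (25 d \deg(\mathcal{G}) |\mathcal{E}|)^2 \max\left(\eta \|C\|_\infty, 68\right)$. If $\mathbb{L}_2$ is tight and $|\mathcal{V}^*_2| = 1$, then the EMP algorithm (run with inputs $C,\eta,\epsilon$) returns a MAP assignment after $\left\lceil \frac{4\mathcal{S}_0(\deg(\mathcal{G})+1)}{\epsilon^2} \right\rceil$ iterations for EMP-cyclic and after $\left\lceil \frac{4\mathcal{S}_0}{\epsilon^2} \right\rceil$ iterations for EMP-greedy.
   Context: Pairwise graphical model on $\mathcal{G}=(\mathcal{V},\mathcal{E})$ with $\mathcal{V}=\{1,\dots,n\}$, every vertex having at least one edge, states $\chi=\{0,\dots,d-1\}$, potentials $\theta_i(x_i)$, $\theta_{ij}(x_i,x_j)$; MAP inference is $\max_{x\in\chi^n}\sum_i\theta_i(x_i)+\sum_{ij}\theta_{ij}(x_i,x_j)$. A marginal vector $\Gamma$ consists of vectors $\Gamma_i\in\mathbb{R}_+^d$ and matrices $\Gamma_{ij}\in\mathbb{R}_+^{d\times d}$. The local polytope is $\mathbb{L}_2=\{\Gamma\ge 0: \Gamma_i\in\Sigma_d\ \forall i,\ \Gamma_{ij}\mathbbm{1}=\Gamma_i,\ \Gamma_{ij}^\top\mathbbm{1}=\Gamma_j\ \forall ij\}$, where $\Sigma_d$ is the probability simplex. Let $C=-\theta$. The LP relaxation is $\min\langle C,\Gamma\rangle$ over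 $\mathbb{L}_2$; $\mathbb{L}_2$ is called tight if this LP has an integral optimal solution. $\mathcal{V}_2$ is the set of vertices of $\mathbb{L}_2$, $\mathcal{V}^*_2$ the set of optimal vertices w.r.t. $C$, and $\Delta=\min_{V_1\in\mathcal{V}_2\setminus\mathcal{V}_2^*,V_2\in\mathcal{V}_2^*}\langle C,V_1\rangle-\langle C,V_2\rangle$. The entropy-regularized problem is $\min_{\Gamma\in\mathbb{L}_2}\langle C,\Gamma\rangle-\frac1\eta H(\Gamma)$ with $H(\Gamma)=\langle\Gamma,-\log\Gamma+\mathbbm{1}\rangle$, equivalently the Bregman (KL) projection of $\exp(-\eta C)$ onto $\mathbb{L}_2$. EMP (edge-based message passing) initializes $\Gamma$ as $\exp(-\eta C)$ with each vertex and edge component normalized to sum to one, and for an edge $ij$ applies closed-form Bregman projections: left consistency $\Gamma_{ij}(x_i,x_j)\leftarrow\Gamma_{ij}(x_i,x_j)\sqrt{\Gamma_i(x_i)/\sum_x\Gamma_{ij}(x_i,x)}$, $\Gamma_i(x_i)\leftarrow\Gamma_i(x_i)\sqrt{\sum_x\Gamma_{ij}(x_i,x)/\Gamma_i(x_i)}$; left normalization (normalize $\Gamma_i$ and $\Gamma_{ij}$ to sum to one); and the analogous right consistency/normalization with columns and vertex $j$. EMP-cyclic, in each iteration, applies left consistency, left normalization, right consistency, right normalization to every edge in order; EMP-greedy, in each iteration, picks the edge and side with the largest violation $\max\{\|\Gamma_{ij}\mathbbm{1}-\Gamma_i\|_1,\|\Gamma_{ij}^\top\mathbbm{1}-\Gamma_j\|_1\}$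 and applies that side's consistency then normalization. Both stop once all violations $\|\Gamma_{ij}\mathbbm{1}-\Gamma_i\|_1$, $\|\Gamma_{ij}^\top\mathbbm{1}-\Gamma_j\|_1$ are below $\epsilon$, and return the rounding $x_i=\arg\max_x\Gamma_i(x)$. $\deg(\mathcal{G})$ is the maximum degree. $\mathcal{S}_0=\min(\|\eta C/d+\exp(-\eta C)\|_1, S)$ with $S=\sum_{ij\in\mathcal{E}}[\log\sum_{x_i,x_j}e^{-\eta C_{ij}(x_i,x_j)}+\sum_{x_i,x_j}\frac{\eta}{d^2}C_{ij}(x_i,x_j)]+\sum_{i\in\mathcal{V}}[\log\sum_x e^{-\eta C_i(x)}+\sum_x\frac{\eta}{d}C_i(x)]$. *)

(* Defs.v *)
From HB Require Import structures.
From mathcomp Require Import all_boot all_order all_algebra.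
From mathcomp Require Import all_classical all_reals all_analysis.
Set Implicit Arguments. Unset Strict Implicit. Unset Printing Implicit Defensive.
Import Order.TTheory GRing.Theory Num.Theory.
Local Open Scope ring_scope.
Local Open Scope classical_set_scope.

(* Pairwise graphical model on the graph with vertices 'I_n, edges 'I_m,
   edge e = (src e, dst e) (the pair ij with i = src e, j = dst e),
   states 'I_d = {0,...,d-1}. *)

Section EMP.
Variables (R : realType) (n d m : nat).
Variables (src dst : 'I_m -> 'I_n).

(* A marginal vector (also used for cost vectors C = -theta):
   vertex components Gamma_i(x) and edge components Gamma_ij(x_i,x_j). *)
Record marg := Marg {
  mv : 'I_n -> 'I_d -> R ;
  me : 'I_m -> 'I_d -> 'I_d -> R }.

Definition simple_graph : Prop :=
  (forall e, src e != dst e) /\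
  (forall e f, (src e = src f /\ dst e = dst f) \/ (src e = dst f /\ dst e = src f)
               -> e = f) /\
  (forall i, exists e, src e = i \/ dst e = i).

Definition inner (C G : marg) : R :=
  \sum_(i < n) \sum_(x < d) mv C i x * mv G i x
  + \sum_(e < m) \sum_(x < d) \sum_(y < d) me C e x y * me G e x y.

Definition rowsum (G : marg) (e : 'I_m) (x : 'I_d) : R := \sum_(y < d) me G e x y.
Definition colsum (G : marg) (e : 'I_m) (y : 'I_d) : R := \sum_(x < d) me G e x y.

Definition in_L2 (G : marg) : Prop :=
  (forall i x, 0 <= mv G i x) /\ (forall e x y, 0 <= me G e x y) /\
  (forall i, \sum_(x < d) mv G i x = 1) /\
  (forall e x, rowsum G e x = mv G (src e) x) /\
  (forall e y, colsum G e y = mv G (dst e) y).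

Definition mix (t : R) (A B : marg) : marg :=
  Marg (fun i x => t * mv A i x + (1 - t) * mv B i x)
       (fun e x y => t * me A e x y + (1 - t) * me B e x y).

Definition is_vertex (G : marg) : Prop :=
  in_L2 G /\
  forall A B t, in_L2 A -> in_L2 B -> 0 < t < 1 -> G = mix t A B -> A = B.

Definition lp_optimal (C G : marg) : Prop :=
  in_L2 G /\ forall H, in_L2 H -> inner C G <= inner C H.

Definition integral (G : marg) : Prop :=
  (forall i x, mv G i x \is a Num.int) /\ (forall e x y, me G e x y \is a Num.int).

Definition tight (C : marg) : Prop := exists G, lp_optimal C G /\ integral G.

Definition opt_vertex (C G : marg) : Prop := is_vertex G /\ lp_optimal C G.

Definition unique_opt_vertex (C : marg) : Prop :=
  exists G, opt_vertex C G /\ forall H, opt_vertex C H -> H = G.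

Definition Delta (C : marg) : R :=
  inf [set r | exists V1 V2, is_vertex V1 /\ ~ opt_vertex C V1 /\
                            opt_vertex C V2 /\ r = inner C V1 - inner C V2].

Definition deg (i : 'I_n) : nat := #|[set e : 'I_m | (src e == i) || (dst e == i)]|.
Definition maxdeg : nat := \max_(i < n) deg i.

Definition normInf (C : marg) : R :=
  Num.max (\big[Num.max/0]_(i < n) \big[Num.max/0]_(x < d) `|mv C i x|)
          (\big[Num.max/0]_(e < m) \big[Num.max/0]_(x < d) \big[Num.max/0]_(y < d)
              `|me C e x y|).

Definition norm1_init (C : marg) (eta : R) : R :=
  \sum_(i < n) \sum_(x < d) `|eta * mv C i x / d%:R + expR (- (eta * mv C i x))|
  + \sum_(e < m) \sum_(x < d) \sum_(y < d)
       `|eta * me C e x y / d%:R + expR (- (eta * me C e x y))|.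

Definition S_quant (C : marg) (eta : R) : R :=
  \sum_(e < m) (ln (\sum_(x < d) \sum_(y < d) expR (- (eta * me C e x y)))
                + \sum_(x < d) \sum_(y < d) eta / (d%:R ^+ 2) * me C e x y)
  + \sum_(i < n) (ln (\sum_(x < d) expR (- (eta * mv C i x)))
                + \sum_(x < d) eta / d%:R * mv C i x).

Definition S0 (C : marg) (eta : R) : R := Num.min (norm1_init C eta) (S_quant C eta).

Definition emp_init (C : marg) (eta : R) : marg :=
  Marg (fun i x => expR (- (eta * mv C i x)) / \sum_(y < d) expR (- (eta * mv C i y)))
       (fun e x y => expR (- (eta * me C e x y)) /
                     \sum_(x' < d) \sum_(y' < d) expR (- (eta * me C e x' y'))).

Definition upd_v (G : marg) (i : 'I_n) (f : 'I_d -> R) : marg :=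
  Marg (fun i' => if i' == i then f else mv G i') (me G).
Definition upd_e (G : marg) (e : 'I_m) (f : 'I_d -> 'I_d -> R) : marg :=
  Marg (mv G) (fun e' => if e' == e then f else me G e').

Definition left_cons (G : marg) (e : 'I_m) : marg :=
  let i := src e in
  upd_v (upd_e G e (fun x y => me G e x y * Num.sqrt (mv G i x / rowsum G e x))) i
        (fun x => mv G i x * Num.sqrt (rowsum G e x / mv G i x)).

Definition right_cons (G : marg) (e : 'I_m) : marg :=
  let j := dst e in
  upd_v (upd_e G e (fun x y => me G e x y * Num.sqrt (mv G j y / colsum G e y))) j
        (fun y => mv G j y * Num.sqrt (colsum G e y / mv G j y)).

Definition normalize_e (G : marg) (e : 'I_m) : marg :=
  upd_e G e (fun x y => me G e x y / \sum_(x' < d) \sum_(y' < d) me G e x' y').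
Definition normalize_v (G : marg) (i : 'I_n) : marg :=
  upd_v G i (fun x => mv G i x / \sum_(y < d) mv G i y).

Definition left_norm (G : marg) (e : 'I_m) : marg := normalize_e (normalize_v G (src e)) e.
Definition right_norm (G : marg) (e : 'I_m) : marg := normalize_e (normalize_v G (dst e)) e.

Definition left_step (G : marg) (e : 'I_m) : marg := left_norm (left_cons G e) e.
Definition right_step (G : marg) (e : 'I_m) : marg := right_norm (right_cons G e) e.

Definition cyclic_iteration (G : marg) : marg :=
  foldl (fun G e => right_step (left_step G e) e) G (enum 'I_m).

Definition cyclic_traj (C : marg) (eta : R) (t : nat) : marg :=
  iter t cyclic_iteration (emp_init C eta).

Definition viol_left (G : marg) (e : 'I_m) : R :=
  \sum_(x < d) `|rowsum G e x - mv G (src e) x|.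
Definition viol_right (G : marg) (e : 'I_m) : R :=
  \sum_(y < d) `|colsum G e y - mv G (dst e) y|.

(* one iteration of EMP-greedy (ties broken arbitrarily):
   side = false is the left side, side = true the right side *)
Definition greedy_iteration (G G' : marg) : Prop :=
  exists (e : 'I_m) (side : bool),
    (forall f, Num.max (viol_left G f) (viol_right G f)
               <= (if side then viol_right G e else viol_left G e)) /\
    G' = (if side then right_step G e else left_step G e).

Definition greedy_traj (C : marg) (eta eps : R) (traj : nat -> marg) : Prop :=
  traj 0%N = emp_init C eta /\
  forall t, ~ (forall e, viol_left (traj t) e < eps /\ viol_right (traj t) e < eps) ->
            greedy_iteration (traj t) (traj t.+1).

Definition stopped (eps : R) (G : marg) : Prop :=
  forall e, viol_left G e < eps /\ viol_right G e < eps.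

Definition is_rounding (G : marg) (x : 'I_n -> 'I_d) : Prop :=
  forall i y, mv G i y <= mv G i (x i).

(* MAP assignment for theta = - C *)
Definition map_objective (C : marg) (x : 'I_n -> 'I_d) : R :=
  \sum_(i < n) (- mv C i (x i)) + \sum_(e < m) (- me C e (x (src e)) (x (dst e))).
Definition is_MAP (C : marg) (x : 'I_n -> 'I_d) : Prop :=
  forall y, map_objective C y <= map_objective C x.

Definition returns_MAP_within (C : marg) (eps : R) (traj : nat -> marg) (K : R) : Prop :=
  exists t : nat, (t%:Z <= Num.ceil K)%R /\ stopped eps (traj t) /\
    (forall s, (s < t)%N -> ~ stopped eps (traj s)) /\
    (forall x, is_rounding (traj t) x -> is_MAP C x).

End EMP.

(* Main.v *)
Require Import Defs.
From HB Require Import structures.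
From mathcomp Require Import all_boot all_order all_algebra.
From mathcomp Require Import all_classical all_reals all_analysis.
From mathcomp Require Import lra ring.
Import Order.TTheory GRing.Theory Num.Theory.
Local Open Scope ring_scope.
Set Implicit Arguments.
Unset Strict Implicit.
Unset Printing Implicit Defensive.

(** Convergence. A step replaces the vertex distribution [p] and the edge
    marginal [q] that it compares by their normalised geometric mean, and
    rescales the edge component accordingly. The potential is the cross entropy
    of the uniform marginal vector relative to the iterate; the step lowers it
    by [gain = - 2 ln (sum sqrt (p q))], and [2 sqrt gain] dominates the l1
    distance of [p] and [q] as well as the l1 displacement of either component.
    The potential starts at [S] and stays nonnegative, which bounds the number
    of greedy iterations; in a sweep only [deg + 1] steps can affect a given
    violation, and Cauchy-Schwarz gives the cyclic bound.

    Correctness. Every iterate is a Gibbs vector: [log Gamma + eta C] is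
    orthogonal to the directions of the local polytope. At the stopping time
    [Gamma] therefore minimises the entropic objective among the vectors with
    the same violations, hence is nearly as cheap as the optimal vertex, up to
    [(n + 2 m) ln d / eta] and [O(eps)] terms. A nearby point of the local
    polytope then has weight at least [9/10] on the optimal vertex, because all
    other vertices cost [Delta] more. *)

Lemma int_num01 (R : archiRealDomainType) (x : R) :
  x \is a Num.int -> 0 <= x <= 1 -> x = 0 \/ x = 1.
Proof.
move=> /intrP[z ->]; rewrite ler0z lerz1.
by case: z => [[|[|k]]|k] //; [left|right].
Qed.

Lemma sum_mul_pred1 (R : pzSemiRingType) (T : finType) (t : T) (f : T -> R) :
  \sum_s f s * (s == t)%:R = f t.
Proof.
rewrite (bigD1 t) //= eqxx mulr1 big1 ?addr0 // => s /negbTE ->.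
exact: mulr0.
Qed.

Lemma positive_values_bounded_away (R : realDomainType) (T : finType)
    (f : T -> R) :
  exists2 s, 0 < s & forall t, 0 < f t -> s <= f t.
Proof.
exists (\big[Num.min/1]_(t | 0 < f t) f t).
  by apply/bigmin_gtP; split=> //; apply: ltr01.
by move=> t ft; apply: bigmin_le_cond.
Qed.

Lemma CauchySchwarz_sum (R : realDomainType) (T : finType) (f g : T -> R) :
  (\sum_t f t * g t) ^+ 2 <= (\sum_t f t ^+ 2) * (\sum_t g t ^+ 2).
Proof.
have : 0 <= \sum_s \sum_t (f s * g t - f t * g s) ^+ 2.
  by apply: sumr_ge0 => s _; apply: sumr_ge0 => t _; apply: sqr_ge0.
have -> : \sum_s \sum_t (f s * g t - f t * g s) ^+ 2
    = \sum_s \sum_t f s ^+ 2 * g t ^+ 2 + \sum_s \sum_t g s ^+ 2 * f t ^+ 2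
      - 2 * \sum_s \sum_t f s * g s * (f t * g t).
  rewrite mulr_sumr -big_split /= -sumrB; apply: eq_bigr => s _.
  by rewrite mulr_sumr -big_split /= -sumrB; apply: eq_bigr => t _; ring.
rewrite -!big_distrlr /=; lra.
Qed.

Section SquareRoots.
Variable R : rcfType.
Implicit Types x y w : R.

Lemma mul_sqrt_div x y : 0 < x -> 0 < y ->
  x * Num.sqrt (y / x) = Num.sqrt (x * y).
Proof.
move=> x_gt0 y_gt0; have -> : x * y = x ^+ 2 * (y / x).
  by field; rewrite gt_eqF.
by rewrite [RHS]sqrtrM ?sqr_ge0 // sqrtr_sqr gtr0_norm.
Qed.

Lemma le_mul2_sqrt x y : 0 <= x -> 0 <= y ->
  (x <= 2 * Num.sqrt y) = (x ^+ 2 <= 4 * y).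
Proof.
move=> x_ge0 y_ge0; have -> : 4 * y = (2 * Num.sqrt y) ^+ 2.
  by rewrite exprMn sqr_sqrtr // -natrX.
by rewrite ler_pXn2r ?nnegrE ?mulr_ge0.
Qed.

Lemma sqrt_add_sqrt_mul_le x y w : 0 <= x -> 0 <= y -> 0 <= w ->
  Num.sqrt x + Num.sqrt (w * y) <= Num.sqrt ((w + 1) * (x + y)).
Proof.
move=> x_ge0 y_ge0 w_ge0; rewrite (sqrtrM _ w_ge0).
rewrite -[leLHS]ger0_norm ?addr_ge0 ?mulr_ge0 // -sqrtr_sqr ler_wsqrtr //.
rewrite -{2}(sqr_sqrtr x_ge0) -{2}(sqr_sqrtr y_ge0) -{2}(sqr_sqrtr w_ge0).
have := sqr_ge0 (Num.sqrt w * Num.sqrt x - Num.sqrt y); lra.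
Qed.

End SquareRoots.

Section LnExpR.
Variable R : realType.
Implicit Types x u w : R.

Lemma ln_le_subr1 x : 0 < x -> ln x <= x - 1.
Proof.
by move=> x_gt0; rewrite -{1}(subrKC 1 x) le_ln1Dx // ltrBrDr addNr.
Qed.

Lemma ln_le_half x : 0 < x -> ln x <= x / 2.
Proof.
move=> x_gt0; have -> : ln x = ln (x / 2) + ln 2.
  by rewrite -lnM ?posrE ?divr_gt0 // divfK.
have := @ln_le_subr1 (x / 2) (divr_gt0 x_gt0 (ltr0n _ 2)).
have := @ln_le_subr1 2 (ltr0n _ 2); lra.
Qed.

Lemma ln_sqrt x : 0 <= x -> ln (Num.sqrt x) = ln x / 2.
Proof. by move=> x_ge0; rewrite -powR12_sqrt // ln_powR mulrC. Qed.

Lemma half_expR_add_le x u w : u ^+ 2 <= w -> w <= u ->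
  expR (- x) / 2 + x * w <= `|x * u + expR (- x)|.
Proof.
move=> uw wu; apply: le_trans (ler_norm _).
have := expR_ge1Dx (- x); have := expR_gt0 (- x).
set E := expR (- x) => E_gt0 E_ge.
have [x_ge0|x_lt0] := leP 0 x.
  have := ler_wpM2l x_ge0 wu; lra.
have uw4 : u - w <= 1 / 4 by have := sqr_ge0 (u - 1 / 2); lra.
have : - x * (u - w) <= - x * (1 / 4) by rewrite ler_wpM2l // oppr_ge0 ltW.
lra.
Qed.

End LnExpR.

Section Distributions.
Variables (R : realType) (T : finType).
Implicit Types (a b c f : T -> R) (s t : T).

Definition is_dist a := (forall t, 0 <= a t) /\ \sum_t a t = 1.
Definition pos_dist a := (forall t, 0 < a t) /\ \sum_t a t = 1.

Lemma pos_dist_is_dist a : pos_dist a -> is_dist a.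
Proof. by move=> [a_gt0 suma]; split=> // t; apply: ltW. Qed.

Lemma is_dist_card_gt0 a : is_dist a -> (0 < #|T|)%N.
Proof.
move=> [_ suma]; rewrite lt0n; apply/eqP => /card0_eq T0.
by move/eqP: suma; rewrite big_pred0 1?eq_sym ?oner_eq0.
Qed.

Lemma sum_pos_gt0 a : (0 < #|T|)%N -> (forall t, 0 < a t) -> 0 < \sum_t a t.
Proof.
move=> /card_gt0P[t _] a_gt0.
by rewrite (bigD1 t) //= ltr_wpDr ?sumr_ge0 // => *; apply: ltW.
Qed.

Lemma is_dist_le1 a t : is_dist a -> a t <= 1.
Proof. by move=> [a_ge0 <-]; rewrite (bigD1 t) //= lerDl sumr_ge0. Qed.

Lemma is_dist_mix (x : R) a b : 0 <= x <= 1 -> is_dist a -> is_dist b ->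
  is_dist (fun t => (1 - x) * a t + x * b t).
Proof.
move=> /andP[x_ge0 x_le1] [a_ge0 suma] [b_ge0 sumb]; split=> [t|].
  by rewrite addr_ge0 ?mulr_ge0 ?subr_ge0.
by rewrite big_split /= -!mulr_sumr suma sumb; ring.
Qed.

Lemma is_dist_average_le a f (N : R) : is_dist a -> (forall t, `|f t| <= N) ->
  `|\sum_t f t * a t| <= N.
Proof.
move=> [a_ge0 suma] f_le; apply: le_trans (ler_norm_sum _ _ _) _.
rewrite -[N]mulr1 -suma mulr_sumr; apply: ler_sum => t _.
by rewrite normrM (ger0_norm (a_ge0 t)) ler_wpM2r.
Qed.

Lemma is_dist_sum_ln_le0 a f : is_dist a -> (forall t, 0 <= f t) ->
  \sum_t ln (a t) * f t <= 0.
Proof.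
move=> da f_ge0; apply: sumr_le0 => t _.
by rewrite mulr_le0_ge0 // ln_le0 // is_dist_le1.
Qed.

Lemma is_dist_majority a s t : is_dist a -> 1 / 2 < a s ->
  (forall r, a r <= a t) -> t = s.
Proof.
move=> [a_ge0 suma] half /(_ s) le_st; apply/eqP; apply: contraT => ts.
have : 0 <= \sum_(r | (r != s) && (r != t)) a r by apply: sumr_ge0.
by move: suma; rewrite (bigD1 s) //= (bigD1 t) //=; lra.
Qed.

Lemma is_dist_integral_point_mass a :
  is_dist a -> (forall t, a t \is a Num.int) ->
  exists s, forall t, a t = (t == s)%:R.
Proof.
move=> da int_a; have a01 t : a t = 0 \/ a t = 1.
  by apply: int_num01 => //; rewrite da.1 is_dist_le1.
have [s as1] : exists s, a s = 1.
  apply: contrapT => none; have := da.2; rewrite big1 => [/esym/eqP|t _].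
    by rewrite oner_eq0.
  by case: (a01 t) => // at1; case: none; exists t.
exists s => t; have [-> //|ts] := eqVneq t s.
case: (a01 t) => // at1; move/eqP: ts; case.
apply: (is_dist_majority da) => [|r]; first by rewrite as1; lra.
by rewrite at1 is_dist_le1.
Qed.

Definition uniform_dist : T -> R := fun=> #|T|%:R^-1.

Lemma uniform_pos_dist : (0 < #|T|)%N -> pos_dist uniform_dist.
Proof.
move=> T_gt0; split=> [t|]; first by rewrite invr_gt0 ltr0n.
by rewrite sumr_const -[_ *+ _]mulr_natr mulVf // pnatr_eq0 -lt0n.
Qed.

Definition l1_dist a b := \sum_t `|a t - b t|.

Lemma l1_dist_ge0 a b : 0 <= l1_dist a b.
Proof. exact: sumr_ge0. Qed.

Lemma l1_distC a b : l1_dist a b = l1_dist b a.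
Proof. by apply: eq_bigr => t _; rewrite distrC. Qed.

Lemma l1_dist_triangle b a c : l1_dist a c <= l1_dist a b + l1_dist b c.
Proof. by rewrite -big_split; apply: ler_sum => t _; apply: ler_distD. Qed.

Definition affinity a b := \sum_t Num.sqrt (a t * b t).

Lemma affinity_gt0 a b : pos_dist a -> pos_dist b -> 0 < affinity a b.
Proof.
move=> da db; apply: sum_pos_gt0 => [|t].
  exact: is_dist_card_gt0 (pos_dist_is_dist da).
by rewrite sqrtr_gt0 mulr_gt0 ?da.1 ?db.1.
Qed.

Lemma sum_sqr_sqrtB a b : is_dist a -> is_dist b ->
  \sum_t (Num.sqrt (a t) - Num.sqrt (b t)) ^+ 2 = 2 - 2 * affinity a b.
Proof.
move=> [a_ge0 suma] [b_ge0 sumb].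
under eq_bigr do rewrite sqrrB !sqr_sqrtr // -sqrtrM // addrAC.
by rewrite sumrB big_split /= suma sumb sumrMnl mulr_natl.
Qed.

Lemma sum_sqr_sqrtD a b : is_dist a -> is_dist b ->
  \sum_t (Num.sqrt (a t) + Num.sqrt (b t)) ^+ 2 = 2 + 2 * affinity a b.
Proof.
move=> [a_ge0 suma] [b_ge0 sumb].
under eq_bigr do rewrite sqrrD !sqr_sqrtr // -sqrtrM // addrAC.
by rewrite 2!big_split /= suma sumb sumrMnl mulr_natl.
Qed.

Lemma affinity_le1 a b : is_dist a -> is_dist b -> affinity a b <= 1.
Proof.
move=> da db; have := sum_sqr_sqrtB da db.
have : 0 <= \sum_t (Num.sqrt (a t) - Num.sqrt (b t)) ^+ 2.
  by apply: sumr_ge0 => t _; apply: sqr_ge0.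
lra.
Qed.

Lemma sqr_l1_dist_le_affinity a b : is_dist a -> is_dist b ->
  l1_dist a b ^+ 2 <= 8 * (1 - affinity a b).
Proof.
move=> da db; have [a_ge0 _] := da; have [b_ge0 _] := db.
have := CauchySchwarz_sum (fun t => `|Num.sqrt (a t) - Num.sqrt (b t)|)
                          (fun t => Num.sqrt (a t) + Num.sqrt (b t)).
under eq_bigr => t _.
  rewrite -[X in _ * X]ger0_norm ?addr_ge0 // -normrM -subr_sqr !sqr_sqrtr //.
  over.
under [X in _ <= X * _]eq_bigr do rewrite real_normK ?num_real //.
rewrite sum_sqr_sqrtB // sum_sqr_sqrtD // -/(l1_dist a b) => /le_trans; apply.
have := affinity_le1 da db; have := sqr_ge0 (1 - affinity a b); lra.
Qed.

Definition KL a b := \sum_t (ln (a t) - ln (b t)) * a t.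

Lemma affinity_le_KL a b : pos_dist a -> pos_dist b ->
  2 * (1 - affinity a b) <= KL a b.
Proof.
move=> [a_gt0 suma] [b_gt0 _]; rewrite -[X in X - _]suma -sumrB mulr_sumr.
apply: ler_sum => t _; have ba_gt0 : 0 < b t / a t by rewrite divr_gt0.
have := @ln_le_subr1 _ (Num.sqrt (b t / a t)).
rewrite sqrtr_gt0 ba_gt0 => /(_ isT).
rewrite (ln_sqrt (ltW ba_gt0)) ln_div ?posrE //.
rewrite -(mul_sqrt_div (a_gt0 t)) // => ln_le.
have := ler_wpM2r (ltW (a_gt0 t)) ln_le; lra.
Qed.

Lemma KL_ge0 a b : pos_dist a -> pos_dist b -> 0 <= KL a b.
Proof.
move=> da db; apply: le_trans (affinity_le_KL da db).
by rewrite mulr_ge0 // subr_ge0 affinity_le1 //; apply: pos_dist_is_dist.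
Qed.

Lemma l1_dist_le_KL a b : pos_dist a -> pos_dist b ->
  l1_dist a b <= 2 * Num.sqrt (KL a b).
Proof.
move=> da db; rewrite le_mul2_sqrt ?l1_dist_ge0 ?KL_ge0 //.
have := sqr_l1_dist_le_affinity (pos_dist_is_dist da) (pos_dist_is_dist db).
have := affinity_le_KL da db; lra.
Qed.

Lemma entropy_le_ln_card a :
  pos_dist a -> - \sum_t ln (a t) * a t <= ln #|T|%:R.
Proof.
move=> da; have T_gt0 := is_dist_card_gt0 (pos_dist_is_dist da).
have := KL_ge0 da (uniform_pos_dist T_gt0); rewrite /KL.
under eq_bigr do rewrite lnV ?posrE ?ltr0n // opprK mulrDl.
by rewrite big_split /= -mulr_sumr da.2; lra.
Qed.

Definition normalize a : T -> R := fun t => a t / \sum_s a s.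

Lemma normalize_pos_dist a : (0 < #|T|)%N -> (forall t, 0 < a t) ->
  pos_dist (normalize a).
Proof.
move=> T_gt0 a_gt0; have sum_gt0 := sum_pos_gt0 T_gt0 a_gt0.
by split=> [t|]; [apply: divr_gt0|rewrite -mulr_suml divff // gt_eqF].
Qed.

Definition softmax c : T -> R := normalize (fun t => expR (c t)).

Lemma softmax_pos_dist c : (0 < #|T|)%N -> pos_dist (softmax c).
Proof. by move=> T_gt0; apply: normalize_pos_dist => // t; apply: expR_gt0. Qed.

Definition log_partition c : R := ln (\sum_t expR (c t)).

Lemma ln_softmax c t : (0 < #|T|)%N -> ln (softmax c t) = c t - log_partition c.
Proof.
move=> T_gt0; rewrite ln_div ?posrE ?expR_gt0 // ?expRK //.
by apply: sum_pos_gt0 => // s; apply: expR_gt0.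
Qed.

(* With [u = 1 / d], both vertex components ([#|T| = d]) and edge components
   ([#|T| = d ^ 2]) satisfy the hypothesis. *)
Lemma log_partition_uniform_le c u :
  (0 < #|T|)%N -> u ^+ 2 <= #|T|%:R^-1 <= u ->
  log_partition (fun t => - c t) + \sum_t c t * uniform_dist t
  <= \sum_t `|c t * u + expR (- c t)|.
Proof.
move=> T_gt0 /andP[uT Tu]; apply: (@le_trans _ _
  ((\sum_t expR (- c t)) / 2 + \sum_t c t * uniform_dist t)).
  by rewrite lerD2r; apply/ln_le_half/sum_pos_gt0 => // t; apply: expR_gt0.
by rewrite mulr_suml -big_split; apply: ler_sum => t _; apply: half_expR_add_le.
Qed.

End Distributions.

Lemma is_dist_prod (R : realType) (S T : finType) (a : S -> R) (b : T -> R) :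
  is_dist a -> is_dist b -> is_dist (fun z : S * T => a z.1 * b z.2).
Proof.
move=> [a_ge0 suma] [b_ge0 sumb]; split=> [z|]; first exact: mulr_ge0.
rewrite -(pair_bigA _ (fun s t => a s * b t)) /= -suma; apply: eq_bigr => s _.
by rewrite -mulr_sumr sumb mulr1.
Qed.

(* [p] and [mu] play the roles of a vertex and an edge component. The matched
   pair is the Bregman projection of [(p, mu)] onto the pairs of distributions
   in which the first is the marginal of the second. *)
Section MarginalMatching.
Variables (R : realType) (S T : finType) (proj : T -> S).
Hypothesis proj_surj : forall s, exists t, proj t = s.
Implicit Types (P p : S -> R) (M mu : T -> R).

Definition marginal mu s := \sum_(t | proj t == s) mu t.

Lemma sum_marginal_mul mu (h : S -> R) :
  \sum_s h s * marginal mu s = \sum_t h (proj t) * mu t.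
Proof.
rewrite [RHS](partition_big proj predT) //=; apply: eq_bigr => s _.
by rewrite mulr_sumr; apply: eq_bigr => t /eqP ->.
Qed.

Lemma sum_marginal mu : \sum_s marginal mu s = \sum_t mu t.
Proof. by rewrite [RHS](partition_big proj predT). Qed.

Lemma le_marginal mu t : (forall r, 0 <= mu r) -> mu t <= marginal mu (proj t).
Proof. by move=> mu_ge0; rewrite /marginal (bigD1 t) //= lerDl sumr_ge0. Qed.

Lemma marginal_pos_dist mu : pos_dist mu -> pos_dist (marginal mu).
Proof.
move=> [mu_gt0 summu]; split=> [s|]; last by rewrite sum_marginal.
have [t ts] := proj_surj s; rewrite /marginal (bigD1 t) ?ts //=.
by rewrite ltr_wpDr ?sumr_ge0 // => *; apply: ltW.
Qed.

Lemma l1_dist_marginal_le mu M :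
  l1_dist (marginal mu) (marginal M) <= l1_dist mu M.
Proof.
rewrite /l1_dist [leRHS](partition_big proj predT) //=; apply: ler_sum => s _.
by rewrite -sumrB ler_norm_sum.
Qed.

Definition matched_marginal p mu : S -> R :=
  normalize (fun s => p s * Num.sqrt (marginal mu s / p s)).
Definition matched_joint p mu : T -> R :=
  normalize (fun t => mu t * Num.sqrt (p (proj t) / marginal mu (proj t))).
Definition matching_gain p mu : R := - (2 * ln (affinity p (marginal mu))).

Variables (p : S -> R) (mu : T -> R).
Hypotheses (dp : pos_dist p) (dmu : pos_dist mu).

Local Notation q := (marginal mu).
Local Notation Z := (affinity p q).

Let dq : pos_dist q := marginal_pos_dist dmu.
Let Z_gt0 : 0 < Z := affinity_gt0 dp dq.

Lemma matched_marginalE s : matched_marginal p mu s = Num.sqrt (p s * q s) / Z.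
Proof.
rewrite /matched_marginal /normalize mul_sqrt_div ?dp.1 ?dq.1 //; congr (_ / _).
by apply: eq_bigr => r _; rewrite mul_sqrt_div ?dp.1 ?dq.1.
Qed.

Lemma matched_jointE t :
  matched_joint p mu t = mu t * Num.sqrt (p (proj t) / q (proj t)) / Z.
Proof.
congr (_ / _); under eq_bigr do rewrite mulrC.
rewrite -(sum_marginal_mul mu (fun s => Num.sqrt (p s / q s))).
by apply: eq_bigr => s _; rewrite mulrC mul_sqrt_div ?dp.1 ?dq.1 // mulrC.
Qed.

Lemma matched_marginal_pos_dist : pos_dist (matched_marginal p mu).
Proof.
apply: normalize_pos_dist => [|s].
  exact: is_dist_card_gt0 (pos_dist_is_dist dp).
by rewrite mul_sqrt_div ?dp.1 ?dq.1 // sqrtr_gt0 mulr_gt0 ?dp.1 ?dq.1.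
Qed.

Lemma matched_joint_pos_dist : pos_dist (matched_joint p mu).
Proof.
apply: normalize_pos_dist => [|t].
  exact: is_dist_card_gt0 (pos_dist_is_dist dmu).
by rewrite mulr_gt0 ?dmu.1 // sqrtr_gt0 divr_gt0 ?dp.1 ?dq.1.
Qed.

Lemma marginal_matched_joint :
  marginal (matched_joint p mu) = matched_marginal p mu.
Proof.
apply/funext => s; rewrite matched_marginalE [p s * _]mulrC.
rewrite -mul_sqrt_div ?dp.1 ?dq.1 // -mulrA mulr_suml.
by apply: eq_bigr => t /eqP ts; rewrite matched_jointE ts mulrA.
Qed.

Lemma ln_matched_marginal s :
  ln (matched_marginal p mu s) - ln (p s)
  = - ((ln (p s) - ln (q s)) / 2) - ln Z.
Proof.
have pq_gt0 : 0 < p s * q s by rewrite mulr_gt0 ?dp.1 ?dq.1.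
rewrite matched_marginalE ln_div ?posrE ?sqrtr_gt0 // (ln_sqrt (ltW pq_gt0)).
by rewrite lnM ?posrE ?dp.1 ?dq.1 //; field.
Qed.

Lemma ln_matched_joint t :
  ln (matched_joint p mu t) - ln (mu t)
  = (ln (p (proj t)) - ln (q (proj t))) / 2 - ln Z.
Proof.
have pq_gt0 : 0 < p (proj t) / q (proj t) by rewrite divr_gt0 ?dp.1 ?dq.1.
rewrite matched_jointE ln_div ?posrE ?mulr_gt0 ?sqrtr_gt0 ?dmu.1 //.
rewrite lnM ?posrE ?sqrtr_gt0 ?dmu.1 //.
by rewrite (ln_sqrt (ltW pq_gt0)) ln_div ?posrE ?dp.1 ?dq.1 //; ring.
Qed.

Lemma sum_ln_matched P M : marginal M = P ->
  \sum_s (ln (matched_marginal p mu s) - ln (p s)) * P s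
  + \sum_t (ln (matched_joint p mu t) - ln (mu t)) * M t
  = matching_gain p mu * \sum_s P s.
Proof.
move=> <-; under [X in _ + X]eq_bigr do rewrite ln_matched_joint.
rewrite -(sum_marginal_mul M (fun s => (ln (p s) - ln (q s)) / 2 - ln Z)).
rewrite -big_split mulr_sumr; apply: eq_bigr => s _ /=.
by rewrite ln_matched_marginal /matching_gain; ring.
Qed.

(* The Pythagorean identity for the Bregman projection. *)
Lemma KL_matched :
  KL (matched_marginal p mu) p + KL (matched_joint p mu) mu
  = matching_gain p mu.
Proof.
rewrite (sum_ln_matched marginal_matched_joint) matched_marginal_pos_dist.2.
by rewrite mulr1.
Qed.

Lemma matching_gain_ge0 : 0 <= matching_gain p mu.
Proof.
rewrite -KL_matched addr_ge0 // KL_ge0 //.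
  exact: matched_marginal_pos_dist.
exact: matched_joint_pos_dist.
Qed.

Lemma l1_dist_marginal_le_gain :
  l1_dist (marginal mu) p <= 2 * Num.sqrt (matching_gain p mu).
Proof.
rewrite le_mul2_sqrt ?l1_dist_ge0 ?matching_gain_ge0 // l1_distC.
have := sqr_l1_dist_le_affinity (pos_dist_is_dist dp) (pos_dist_is_dist dq).
have := ln_le_subr1 Z_gt0; rewrite /matching_gain; lra.
Qed.

Lemma l1_dist_matched_marginal_le_gain :
  l1_dist p (matched_marginal p mu) <= 2 * Num.sqrt (matching_gain p mu).
Proof.
rewrite l1_distC.
apply: le_trans (l1_dist_le_KL matched_marginal_pos_dist dp) _.
rewrite ler_wpM2l // ler_wsqrtr // -KL_matched lerDl.
exact: KL_ge0 matched_joint_pos_dist dmu.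
Qed.

Lemma l1_dist_matched_joint_le_gain :
  l1_dist mu (matched_joint p mu) <= 2 * Num.sqrt (matching_gain p mu).
Proof.
rewrite l1_distC; apply: le_trans (l1_dist_le_KL matched_joint_pos_dist dmu) _.
rewrite ler_wpM2l // ler_wsqrtr // -KL_matched lerDr.
exact: KL_ge0 matched_marginal_pos_dist dp.
Qed.

End MarginalMatching.

Section Polyhedra.
Variables (R : realFieldType) (V : lmodType R) (I : finType) (J : Type).
Implicit Types (u v w : V).

Definition extreme_point (P : V -> Prop) v :=
  P v /\ forall a b t,
    P a -> P b -> 0 < t < 1 -> v = t *: a + (1 - t) *: b -> a = b.

Definition polyhedron (coord : I -> V -> R) (con : J -> V -> R)
    (rhs : J -> R) v :=
  (forall k, 0 <= coord k v) /\ (forall j, con j v = rhs j).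

Definition in_ker (con : J -> V -> R) w := forall j, con j w = 0.

Variables (coord : I -> {scalar V}) (con : J -> {scalar V}) (rhs : J -> R).

Local Notation P := (polyhedron coord con rhs).

Hypothesis no_recession : forall w,
  in_ker con w -> (forall k, 0 <= coord k w) -> w = 0.

Definition supp v := [set k | coord k v != 0].

Lemma polyhedronB_in_ker u v : P u -> P v -> in_ker con (u - v).
Proof. by move=> [_ cu] [_ cv] j; rewrite linearB /= cu cv subrr. Qed.

Lemma supp_subP u v :
  reflect (forall k, coord k v = 0 -> coord k u = 0) (supp u \subset supp v).
Proof.
apply: (iffP fintype.subsetP) => uv k; last first.
  by rewrite !inE; apply: contra_neq => /uv.
by move=> vk0; have := uv k; rewrite !inE vk0 eqxx; case: eqP => // _ /(_ isT).
Qed.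

Lemma ray_exit v w : P v -> in_ker con w -> w != 0 -> supp w \subset supp v ->
  exists2 s, 0 < s & P (v + s *: w) /\ supp (v + s *: w) \proper supp v.
Proof.
move=> [v_ge0 cv] cw w0 wv.
have [k wk_lt0] : exists k, coord k w < 0.
  apply: contrapT => w_ge0; move/eqP: w0; apply; apply: no_recession => // k.
  by rewrite leNgt; apply/negP => wk; apply: w_ge0; exists k.
have v_gt0 l : coord l w < 0 -> 0 < coord l v.
  move=> wl; rewrite lt_def v_ge0 andbT; apply: contraTneq wl.
  by move=> /(supp_subP _ _ wv) ->; rewrite ltxx.
case: (arg_minP (fun l => coord l v / - coord l w)
  (wk_lt0 : [pred l | coord l w < 0] k)) => k0 /= wk0 k0_min.
set s := coord k0 v / - coord k0 w in k0_min.
have s_gt0 : 0 < s by rewrite divr_gt0 ?oppr_gt0 ?v_gt0.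
(* [s] is the largest step along [w] that keeps all coordinates nonnegative. *)
exists s => //; split; first split=> [l|j]; rewrite ?linearD ?linearZ /=.
- have [wl|wl] := ltP (coord l w) 0.
    by have := k0_min l wl; rewrite ler_pdivlMr ?oppr_gt0 //; lra.
  by rewrite addr_ge0 // mulr_ge0 // ltW.
- by rewrite cv cw mulr0 addr0.
apply/properP; split.
  apply/supp_subP => l vl; rewrite linearD linearZ /= vl.
  by rewrite (supp_subP _ _ wv l vl) mulr0 addr0.
exists k0; rewrite inE; first by rewrite gt_eqF ?v_gt0.
by rewrite negbK linearD linearZ /= /s; apply/eqP; field; rewrite lt_eqF.
Qed.

Lemma nonextreme_direction v : P v -> ~ extreme_point P v ->
  exists w, [/\ in_ker con w, w != 0 & supp w \subset supp v].
Proof.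
move=> Pv not_ext; have [a [b [t [Pa Pb t01 vE ab]]]] : exists a b t,
    [/\ P a, P b, 0 < t < 1, v = t *: a + (1 - t) *: b & a != b].
  apply: contrapT => none; apply: not_ext; split=> // a b t Pa Pb t01 vE.
  by apply/eqP; apply: contraT => ab; case: none; exists a, b, t.
exists (a - b); split; [exact: polyhedronB_in_ker|by rewrite subr_eq0|].
apply/supp_subP => k; rewrite vE !linearD !linearZ linearN /= => vk.
have [t_gt0 t_lt1] := andP t01; have := Pa.1 k; have := Pb.1 k.
by move: vk; nra.
Qed.

Lemma extreme_point_below (f : {scalar V}) v : P v ->
  exists2 w, extreme_point P w & f w <= f v.
Proof.
have [n] := ubnP #|supp v|; elim: n v => // n IHn v leSn Pv.
have [|] := pselect (extreme_point P v); first by exists v.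
move=> /(nonextreme_direction Pv)[w0 [cw0 w0_neq0 w0v]].
have [w [cw w_neq0 wv fw_le0]] : exists w,
    [/\ in_ker con w, w != 0, supp w \subset supp v & f w <= 0].
  have [?|/ltW fw0_ge0] := leP (f w0) 0; first by exists w0.
  exists (- w0); rewrite oppr_eq0 linearN oppr_le0; split=> // [j|].
    by rewrite linearN cw0 oppr0.
  apply/supp_subP => k /(supp_subP _ _ w0v).
  by rewrite linearN /= => ->; rewrite oppr0.
have [s s_gt0 [Pvs /proper_card lt_supp]] := ray_exit Pv cw w_neq0 wv.
have [|u ext_u le_u] := IHn _ _ Pvs; first exact: leq_trans lt_supp leSn.
exists u => //; apply: le_trans le_u _.
by rewrite linearD linearZ /= gerDl mulr_ge0_le0 // ltW.
Qed.

Lemma extreme_point_supp u v :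
  extreme_point P u -> P v -> supp v \subset supp u -> u = v.
Proof.
move=> [Pu ext_u] Pv /supp_subP vu; apply/eqP; apply: contraT => uv.
have [||s s_gt0 [Pus _]] := ray_exit Pu (polyhedronB_in_ker Pu Pv).
- by rewrite subr_eq0.
- by apply/supp_subP => k uk; rewrite linearB /= uk vu // subrr.
have s1_gt0 : 0 < 1 + s by rewrite addr_gt0.
have t01 : 0 < (1 + s)^-1 < 1 by rewrite invr_gt0 s1_gt0 invf_lt1 ?ltrDl.
have : u + s *: (u - v) = v.
  apply: ext_u Pus Pv t01 _; apply: (scalerI (lt0r_neq0 s1_gt0)).
  rewrite scalerDr !scalerA mulrBr mulr1 divff ?gt_eqF // scale1r.
  rewrite [1 + s - 1]addrAC subrr add0r.
  by rewrite -addrA -scalerDr subrK scalerDl scale1r.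
move/eqP; rewrite -subr_eq0 addrAC -{1}[u - v]scale1r -scalerDl scaler_eq0.
by rewrite gt_eqF //= subr_eq0 (negbTE uv).
Qed.

(* Extreme points are determined by their supports, so there are finitely
   many of them. *)
Lemma extreme_point_gap (f : {scalar V}) : exists2 s, 0 < s &
  forall u v, extreme_point P u -> extreme_point P v ->
    f u < f v -> s <= f v - f u.
Proof.
have vertex_of A : exists v, forall u, extreme_point P u -> supp u = A -> u = v.
  have [[v [ext_v <-]]|none] :=
      pselect (exists v, extreme_point P v /\ supp v = A).
    exists v => u ext_u uv; apply: extreme_point_supp => //; last by rewrite uv.
    by case: ext_v.
  by exists 0 => u ext_u uA; case: none; exists u.
have [vertex vertexE] := choice vertex_of.
have [s s_gt0 s_le] := positive_values_bounded_away
  (fun A : {set I} * {set I} => f (vertex A.2) - f (vertex A.1)).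
exists s => // u v ext_u ext_v; have := s_le (supp u, supp v).
by rewrite /= -(vertexE (supp u) u) // -(vertexE (supp v) v) // subr_gt0; apply.
Qed.

(* Some extreme point is at least as good as [u] for [f + delta *: g]; either it
   is [v] or it costs at least [delta] more than [v]. *)
Lemma gap_mul_deficit_le (f g : {scalar V}) (delta : R) v u : 0 <= delta ->
  (forall w, extreme_point P w -> w != v -> f v + delta <= f w /\ 0 <= g w) ->
  g v = 1 -> P u -> delta * (1 - g u) <= f u - f v.
Proof.
move=> delta_ge0 gap gv Pu; pose h w := f w + delta * g w.
have scalar_h : scalar h by move=> a x y; rewrite /h !linearP; ring.
pose hL : {scalar V} := HB.pack h (GRing.isLinear.Build R V R *%R h scalar_h).
have [w ext_w] := extreme_point_below hL Pu; rewrite /= /h => le_u.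
have [wv|/(gap w ext_w)[le_w gw_ge0]] := eqVneq w v.
  by move: le_u; rewrite wv gv; lra.
have := mulr_ge0 delta_ge0 gw_ge0; lra.
Qed.

End Polyhedra.

Lemma descent_first_stop (R : archiRealFieldType) (X : Type)
    (inv stop : X -> Prop) (pot : X -> R) (delta : R) (traj : nat -> X) :
  0 < delta -> (forall x, inv x -> 0 <= pot x) -> inv (traj 0%N) ->
  (forall t, inv (traj t) -> ~ stop (traj t) ->
     inv (traj t.+1) /\ pot (traj t.+1) + delta <= pot (traj t)) ->
  exists t, [/\ stop (traj t), forall s, (s < t)%N -> ~ stop (traj s),
                inv (traj t) & t%:R * delta <= pot (traj 0%N)].
Proof.
move=> delta_gt0 pot_ge0 inv0 decr.
have run t : (forall s, (s < t)%N -> ~ stop (traj s)) ->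
    inv (traj t) /\ pot (traj t) + t%:R * delta <= pot (traj 0%N).
  elim: t => [|t IHt] running; first by rewrite mul0r addr0.
  have [inv_t le_t] := IHt (fun s lt_st => running s (ltnW lt_st)).
  have [inv_t1 le_t1] := decr t inv_t (running t (ltnSn t)); split=> //.
  by rewrite -natr1 mulrDl mul1r; lra.
have [stops|never] := pselect (exists t, `[< stop (traj t) >]); last first.
  have running s : ~ stop (traj s).
    by move=> /asboolP st; apply: never; exists s.
  pose N := Num.bound (pot (traj 0%N) / delta).
  have [/pot_ge0 N_ge0 le_N] := run N (fun s _ => running s).
  have := archi_boundP (divr_ge0 (pot_ge0 _ inv0) (ltW delta_gt0)).
  by rewrite ltr_pdivrMr // -/N; lra.
case: (ex_minnP stops) => t /asboolP stop_t t_min.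
have before s : (s < t)%N -> ~ stop (traj s).
  by move=> lt_st /asboolP /t_min; rewrite leqNgt lt_st.
have [inv_t le_t] := run t before; exists t; split=> //.
by apply: le_trans le_t; rewrite lerDr pot_ge0.
Qed.

Section MarginalVectors.
Variables (R : realType) (n d m : nat).
Local Notation marg := (marg R n d m).
Implicit Types (A B C G Z : marg) (i : 'I_n) (e : 'I_m).

Lemma marg_ext G Z : (forall i x, mv G i x = mv Z i x) ->
  (forall e x y, me G e x y = me Z e x y) -> G = Z.
Proof.
case: G Z => [Gv Ge] [Zv Ze] /= eqv eqe.
by congr Marg; do ?[apply/funext => ?].
Qed.

HB.instance Definition _ := gen_eqMixin marg.
HB.instance Definition _ := gen_choiceMixin marg.

Definition marg_zero : marg := Marg 0 0.
Definition marg_opp G : marg := Marg (- mv G) (- me G).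
Definition marg_add G Z : marg := Marg (mv G + mv Z) (me G + me Z).
Definition marg_scale (a : R) G : marg :=
  Marg (fun i x => a * mv G i x) (fun e x y => a * me G e x y).

Lemma marg_addA : associative marg_add.
Proof. by move=> A B C; apply: marg_ext => *; apply: addrA. Qed.

Lemma marg_addC : commutative marg_add.
Proof. by move=> A B; apply: marg_ext => *; apply: addrC. Qed.

Lemma marg_add0 : left_id marg_zero marg_add.
Proof. by move=> A; apply: marg_ext => *; apply: add0r. Qed.

Lemma marg_addN : left_inverse marg_zero marg_opp marg_add.
Proof. by move=> A; apply: marg_ext => *; apply: addNr. Qed.

HB.instance Definition _ :=
  GRing.isZmodule.Build marg marg_addA marg_addC marg_add0 marg_addN.

Lemma marg_scaleA a b G : marg_scale a (marg_scale b G) = marg_scale (a * b) G.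
Proof. by apply: marg_ext => *; apply: mulrA. Qed.

Lemma marg_scale1 : left_id 1 marg_scale.
Proof. by move=> G; apply: marg_ext => *; apply: mul1r. Qed.

Lemma marg_scaleDr : right_distributive marg_scale +%R.
Proof. by move=> a G Z; apply: marg_ext => *; apply: mulrDr. Qed.

Lemma marg_scaleDl G : {morph marg_scale^~ G : a b / a + b}.
Proof. by move=> a b; apply: marg_ext => *; apply: mulrDl. Qed.

HB.instance Definition _ := GRing.Zmodule_isLmodule.Build R marg
  marg_scaleA marg_scale1 marg_scaleDr marg_scaleDl.

Definition edge_block G e (z : 'I_d * 'I_d) := me G e z.1 z.2.

Definition entry_index := ('I_n * 'I_d + 'I_m * ('I_d * 'I_d))%type.

Definition entry (k : entry_index) G : R :=
  match k with inl (i, x) => mv G i x | inr (e, z) => edge_block G e z end.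

Lemma entry_is_scalar k : scalar (entry k).
Proof. by case: k => [[i x]|[e z]]. Qed.

HB.instance Definition _ k :=
  GRing.isLinear.Build R marg R *%R (entry k) (entry_is_scalar k).

Lemma entry_inj G Z : (forall k, entry k G = entry k Z) -> G = Z.
Proof.
move=> eqGZ; apply: marg_ext => [i x|e x y]; first exact: (eqGZ (inl (i, x))).
exact: (eqGZ (inr (e, (x, y)))).
Qed.

Lemma inner_blocks C G :
  inner C G = \sum_(i < n) \sum_x mv C i x * mv G i x
            + \sum_(e < m) \sum_z edge_block C e z * edge_block G e z.
Proof. by congr (_ + _); apply: eq_bigr => e _; rewrite pair_bigA. Qed.

Lemma inner_is_scalar C : scalar (inner C).
Proof.
move=> a G Z; rewrite !inner_blocks mulrDr addrACA !mulr_sumr -!big_split /=.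
by congr (_ + _); apply: eq_bigr => b _; rewrite mulr_sumr -big_split /=;
  apply: eq_bigr => t _; rewrite mulrDr mulrCA.
Qed.

HB.instance Definition _ C :=
  GRing.isLinear.Build R marg R *%R (inner C) (inner_is_scalar C).

Lemma inner_sub_local A B Z i e :
  (forall j, j != i -> mv A j = mv B j) ->
  (forall f, f != e -> edge_block A f = edge_block B f) ->
  inner A Z - inner B Z =
    \sum_x (mv A i x - mv B i x) * mv Z i x
    + \sum_z (edge_block A e z - edge_block B e z) * edge_block Z e z.
Proof.
move=> eqv eqe; rewrite !inner_blocks opprD addrACA -sumrB -[X in _ + X]sumrB.
congr (_ + _).
  rewrite (bigD1 i) //= [X in _ + X]big1 => [|j /eqv ->]; last exact: subrr.
  by rewrite addr0 -sumrB; apply: eq_bigr => x _; rewrite mulrBl.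
rewrite (bigD1 e) //= [X in _ + X]big1 => [|f /eqe ->]; last exact: subrr.
by rewrite addr0 -sumrB; apply: eq_bigr => z _; rewrite mulrBl.
Qed.

Definition dist_blocks G :=
  (forall i, is_dist (mv G i)) /\ (forall e, is_dist (edge_block G e)).
Definition pos_dist_blocks G :=
  (forall i, pos_dist (mv G i)) /\ (forall e, pos_dist (edge_block G e)).

Lemma pos_dist_blocks_dist G : pos_dist_blocks G -> dist_blocks G.
Proof. by move=> [dv de]; split=> ?; apply: pos_dist_is_dist. Qed.

Lemma dist_blocks_entry_ge0 G k : dist_blocks G -> 0 <= entry k G.
Proof.
by move=> [dv de]; case: k => [[i x]|[e z]]; [apply: (dv i).1|apply: (de e).1].
Qed.

Lemma dist_blocks_entry_le1 G k : dist_blocks G -> entry k G <= 1.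
Proof. by move=> [dv de]; case: k => [[i x]|[e z]]; apply: is_dist_le1. Qed.

Lemma dist_blocks_mix (t : R) A B :
  0 <= t <= 1 -> dist_blocks A -> dist_blocks B ->
  dist_blocks ((1 - t) *: A + t *: B).
Proof.
move=> t01 [Av Ae] [Bv Be]; split=> [i|e].
  exact: (is_dist_mix t01 (Av i) (Bv i)).
exact: (is_dist_mix t01 (Ae e) (Be e)).
Qed.

Definition logm G : marg :=
  Marg (fun i x => ln (mv G i x)) (fun e x y => ln (me G e x y)).

Lemma inner_logm_le0 G Z : dist_blocks G -> (forall k, 0 <= entry k Z) ->
  inner (logm G) Z <= 0.
Proof.
move=> [dv de] Z_ge0; rewrite inner_blocks -[leRHS]addr0.
apply: lerD; apply: sumr_le0.
  move=> i _; apply: (is_dist_sum_ln_le0 (dv i)) => x.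
  exact: (Z_ge0 (inl (i, x))).
move=> e _; apply: (is_dist_sum_ln_le0 (de e)) => z.
exact: (Z_ge0 (inr (e, z))).
Qed.

Lemma marg_entropy_le G : pos_dist_blocks G ->
  - inner (logm G) G <= (n%:R + 2 * m%:R) * ln d%:R.
Proof.
move=> [dv de]; rewrite inner_blocks opprD mulrDl -!sumrN; apply: lerD.
  rewrite mulr_natl -[X in _ *+ X]card_ord -sumr_const; apply: ler_sum => i _.
  by apply: le_trans (entropy_le_ln_card (dv i)) _; rewrite card_ord.
rewrite -mulrA mulrCA mulr_natl -[X in _ *+ X]card_ord -sumr_const.
apply: ler_sum => e _.
apply: le_trans (entropy_le_ln_card (de e)) _.
have := is_dist_card_gt0 (pos_dist_is_dist (de e)).
rewrite card_prod card_ord muln_gt0 andbb => d_gt0.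
by rewrite natrM lnM ?posrE ?ltr0n // mulr_natl.
Qed.

Lemma normr_mv_le_normInf C i x : `|mv C i x| <= normInf C.
Proof.
rewrite le_max; apply/orP; left; apply: le_trans (le_bigmax _ _ i).
exact: (le_bigmax _ (fun x => `|mv C i x|) x).
Qed.

Lemma normr_me_le_normInf C e x y : `|me C e x y| <= normInf C.
Proof.
rewrite le_max; apply/orP; right; apply: le_trans (le_bigmax _ _ e).
apply: le_trans (le_bigmax _ _ x).
exact: (le_bigmax _ (fun y => `|me C e x y|) y).
Qed.

Lemma normInf_ge0 C : 0 <= normInf C.
Proof. by rewrite le_max bigmax_ge_id. Qed.

Lemma normr_inner_le C Z :
  dist_blocks Z -> `|inner C Z| <= normInf C * (n%:R + m%:R).
Proof.
move=> [dv de]; rewrite inner_blocks mulrDr; apply: le_trans (ler_normD _ _) _.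
apply: lerD; apply: le_trans (ler_norm_sum _ _ _) _; rewrite mulr_natr;
  rewrite -[X in _ *+ X]card_ord -sumr_const; apply: ler_sum.
  move=> i _; apply: (is_dist_average_le (dv i)) => x.
  exact: normr_mv_le_normInf.
move=> e _; apply: (is_dist_average_le (de e)) => z.
exact: normr_me_le_normInf.
Qed.

Lemma normr_inner_mix_sub_le C (t : R) A B :
  0 <= t -> dist_blocks A -> dist_blocks B ->
  `|inner C ((1 - t) *: A + t *: B) - inner C A|
  <= 2 * t * normInf C * (n%:R + m%:R).
Proof.
move=> t_ge0 /(normr_inner_le C) le_A /(normr_inner_le C) le_B.
rewrite linearD !linearZ /=.
rewrite (_ : _ - _ = t * (inner C B - inner C A)); last ring.
rewrite normrM (ger0_norm t_ge0) -!mulrA [leRHS]mulrCA ler_wpM2l //.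
by apply: le_trans (ler_normB _ _) _; lra.
Qed.

Definition uniform : marg :=
  Marg (fun=> @uniform_dist R 'I_d)
       (fun _ x y => @uniform_dist R ('I_d * 'I_d)%type (x, y)).

End MarginalVectors.

Section EdgeSides.
Variables (R : realType) (n d m : nat) (src dst : 'I_m -> 'I_n).
Local Notation marg := (marg R n d m).
Implicit Types (C D G Z : marg) (b : bool) (i : 'I_n) (e : 'I_m) (x : 'I_d).

(* The boolean selects the side of an edge: [false] is the source (left, rows),
   [true] the destination (right, columns). *)
Definition endpoint b e := if b then dst e else src e.
Definition side b (z : 'I_d * 'I_d) := if b then z.2 else z.1.

Lemma side_surj b x : exists z, side b z = x.
Proof. by exists (x, x); case: b. Qed.

Definition edge_marg b G e := marginal (side b) (edge_block G e).

Lemma edge_marg_rowsum G e : edge_marg false G e = rowsum G e.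
Proof.
apply/funext => x; rewrite /edge_marg /marginal /=.
rewrite (eq_bigl (fun z => (z.1 == x) && true)) => [|z]; last by rewrite andbT.
by rewrite -(pair_big (pred1 x) predT (me G e)) big_pred1_eq.
Qed.

Lemma edge_marg_colsum G e : edge_marg true G e = colsum G e.
Proof.
apply/funext => y; rewrite /edge_marg /marginal /=.
rewrite -(pair_big predT (pred1 y) (me G e)).
by apply: eq_bigr => x _; rewrite big_pred1_eq.
Qed.

Definition mass i G := \sum_x mv G i x.
Definition slack b e x G := edge_marg b G e x - mv G (endpoint b e) x.

Definition constraint (j : 'I_n + bool * 'I_m * 'I_d) : marg -> R :=
  match j with inl i => mass i | inr (b, e, x) => slack b e x end.
Definition constraint_rhs (j : 'I_n + bool * 'I_m * 'I_d) : R :=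
  if j is inl _ then 1 else 0.

Lemma edge_marg_is_scalar b e x : scalar (fun G => edge_marg b G e x).
Proof.
by move=> a G Z; rewrite /edge_marg /marginal big_split /= mulr_sumr.
Qed.

Lemma constraint_is_scalar j : scalar (constraint j).
Proof.
case: j => [i|[[b e] x]] a G Z /=.
  by rewrite /mass big_split /= mulr_sumr.
rewrite /slack edge_marg_is_scalar (_ : mv (a *: G + Z) _ x
  = a * mv G (endpoint b e) x + mv Z (endpoint b e) x) //; ring.
Qed.

HB.instance Definition _ j :=
  GRing.isLinear.Build R marg R *%R (constraint j) (constraint_is_scalar j).

Lemma in_ker_mass D i : in_ker constraint D -> mass i D = 0.
Proof. by move=> /(_ (inl i)). Qed.

Lemma in_ker_edge_marg D b e :
  in_ker constraint D -> edge_marg b D e = mv D (endpoint b e).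
Proof.
move=> kerD; apply/funext => x; apply/eqP; rewrite -subr_eq0.
exact/eqP/(kerD (inr (b, e, x))).
Qed.

Lemma sum_edge_block G b e : edge_marg b G e = mv G (endpoint b e) ->
  \sum_z edge_block G e z = mass (endpoint b e) G.
Proof.
by move=> cG; rewrite -(sum_marginal (side b)) -/(edge_marg b G e) cG.
Qed.

Definition viol b G e := l1_dist (edge_marg b G e) (mv G (endpoint b e)).

Lemma viol_leftE G e : viol_left src G e = viol false G e.
Proof. by rewrite /viol edge_marg_rowsum. Qed.

Lemma viol_rightE G e : viol_right dst G e = viol true G e.
Proof. by rewrite /viol edge_marg_colsum. Qed.

Lemma stoppedP (eps : R) G :
  stopped src dst eps G <-> forall b e, viol b G e < eps.
Proof.
split=> [stG b e|stG e]; last by rewrite viol_leftE viol_rightE.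
by have := stG e; rewrite viol_leftE viol_rightE; case: b => -[].
Qed.

Lemma not_stopped_viol (eps : R) G :
  ~ stopped src dst eps G -> exists b e, eps <= viol b G e.
Proof.
move=> running; apply: contrapT => small; apply/running/stoppedP => b e.
by rewrite ltNge; apply/negP => large; apply: small; exists b, e.
Qed.

Definition step b G e := if b then right_step dst G e else left_step src G e.
Definition gain b G e :=
  matching_gain (side b) (mv G (endpoint b e)) (edge_block G e).

Lemma step_mv_endpoint b G e : mv (step b G e) (endpoint b e)
  = matched_marginal (side b) (mv G (endpoint b e)) (edge_block G e).
Proof.
rewrite /matched_marginal -/(edge_marg b G e).
by case: b; rewrite ?edge_marg_colsum ?edge_marg_rowsum;
  apply/funext => x /=; rewrite !eqxx.
Qed.

Lemma step_mv_other b G e i : i != endpoint b e -> mv (step b G e) i = mv G i.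
Proof. by case: b => /= /negbTE ie; apply/funext => x; rewrite /= ie. Qed.

Lemma step_edge_block b G e : edge_block (step b G e) e
  = matched_joint (side b) (mv G (endpoint b e)) (edge_block G e).
Proof.
rewrite /matched_joint -/(edge_marg b G e).
case: b; rewrite ?edge_marg_colsum ?edge_marg_rowsum; apply/funext => z;
  by rewrite /edge_block /= !eqxx pair_bigA.
Qed.

Lemma step_edge_block_other b G e f :
  f != e -> edge_block (step b G e) f = edge_block G f.
Proof.
by case: b => /= /negbTE fe; apply/funext => z; rewrite /edge_block /= fe.
Qed.

Lemma step_pos_dist_blocks b G e :
  pos_dist_blocks G -> pos_dist_blocks (step b G e).
Proof.
move=> [dv de]; split=> [i|f].
  have [->|/step_mv_other ->] := eqVneq i (endpoint b e); last exact: dv.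
  rewrite step_mv_endpoint.
  exact: (matched_marginal_pos_dist (side_surj b) (dv (endpoint b e)) (de e)).
have [->|/step_edge_block_other ->] := eqVneq f e; last exact: de.
rewrite step_edge_block.
exact: (matched_joint_pos_dist (side_surj b) (dv (endpoint b e)) (de e)).
Qed.

Lemma gain_ge0 b G e : pos_dist_blocks G -> 0 <= gain b G e.
Proof.
by move=> [dv de]; apply: (matching_gain_ge0 (side_surj b) (dv _) (de e)).
Qed.

Lemma viol_le_gain b G e :
  pos_dist_blocks G -> viol b G e <= 2 * Num.sqrt (gain b G e).
Proof.
move=> [dv de].
exact: (l1_dist_marginal_le_gain (side_surj b) (dv _) (de e)).
Qed.

Lemma inner_logm_step b G e Z : pos_dist_blocks G ->
  edge_marg b Z e = mv Z (endpoint b e) ->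
  inner (logm (step b G e)) Z
  = inner (logm G) Z + gain b G e * mass (endpoint b e) Z.
Proof.
move=> dG cZ; have [dv de] := dG; apply/eqP; rewrite addrC -subr_eq; apply/eqP.
rewrite (@inner_sub_local _ _ _ _ _ _ _ (endpoint b e) e); first last.
- move=> f /(step_edge_block_other b G) stepE; apply/funext => z.
  by rewrite -[LHS]/(ln (edge_block _ f z)) stepE.
- by move=> i /step_mv_other stepE; apply/funext => x; rewrite /= stepE.
rewrite /gain -(sum_ln_matched (side_surj b) (dv (endpoint b e)) (de e) cZ).
congr (_ + _); apply: eq_bigr.
  by move=> x _; rewrite -step_mv_endpoint.
by move=> z _; rewrite -step_edge_block.
Qed.

End EdgeSides.

Section Trajectories.
Variables (R : realType) (n d m : nat) (src dst : 'I_m -> 'I_n).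
Variables (C : marg R n d m) (eta : R).
Implicit Types (D G Z : marg R n d m) (b : bool) (e f : 'I_m) (i : 'I_n).
(* A graph without vertices may come with an empty set of states. *)
Hypothesis d_gt0 : 'I_n -> (0 < d)%N.

Local Notation endpoint := (endpoint src dst).
Local Notation step := (step src dst).
Local Notation gain := (gain src dst).
Local Notation viol := (viol src dst).
Local Notation uniform := (@uniform R n d m).

Lemma mass_uniform i : mass i uniform = 1.
Proof. by apply: (uniform_pos_dist _ _).2; rewrite card_ord (d_gt0 i). Qed.

Lemma edge_marg_uniform b e : edge_marg b uniform e = mv uniform (endpoint b e).
Proof.
have d_neq0 : d%:R != 0 :> R by rewrite pnatr_eq0 -lt0n (d_gt0 (src e)).
apply/funext => x; case: b; rewrite ?edge_marg_colsum ?edge_marg_rowsum;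
  rewrite /colsum /rowsum /= /uniform_dist sumr_const card_prod !card_ord natrM;
  by rewrite -[_ *+ _]mulr_natr; field.
Qed.

Definition potential G : R := - inner (logm G) uniform.

Lemma potential_ge0 G : pos_dist_blocks G -> 0 <= potential G.
Proof.
move=> /pos_dist_blocks_dist dG; rewrite oppr_ge0; apply: inner_logm_le0 => //.
by case=> [[i x]|[e z]]; rewrite /= invr_ge0.
Qed.

Lemma potential_step b G e : pos_dist_blocks G ->
  potential (step b G e) = potential G - gain b G e.
Proof.
move=> dG; rewrite /potential inner_logm_step ?edge_marg_uniform //.
by rewrite mass_uniform mulr1 opprD.
Qed.

Definition gibbs G := forall D, in_ker (constraint src dst) D ->
  inner (logm G) D = - (eta * inner C D).

Definition emp_state G := pos_dist_blocks G /\ gibbs G.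

Lemma emp_state_step b G e : emp_state G -> emp_state (step b G e).
Proof.
move=> [dG gibbsG]; split=> [|D kerD]; first exact: step_pos_dist_blocks.
rewrite inner_logm_step ?(in_ker_edge_marg _ _ kerD) //.
by rewrite (in_ker_mass _ kerD) mulr0 addr0 gibbsG.
Qed.

Local Notation init := (emp_init C eta).
Local Notation log_part_v i := (log_partition (fun x => - (eta * mv C i x))).
Local Notation log_part_e e :=
  (log_partition (fun z => - (eta * edge_block C e z))).

Lemma emp_init_edge_block e :
  edge_block init e = softmax (fun z => - (eta * edge_block C e z)).
Proof. by apply/funext => z; rewrite /edge_block /= pair_bigA. Qed.

Lemma emp_init_pos_dist_blocks : pos_dist_blocks init.
Proof.
split=> [i|e]; first by apply: softmax_pos_dist; rewrite card_ord (d_gt0 i).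
rewrite emp_init_edge_block; apply: softmax_pos_dist.
by rewrite card_prod card_ord muln_gt0 (d_gt0 (src e)).
Qed.

Lemma inner_logm_init Z : inner (logm init) Z =
  - (eta * inner C Z) - \sum_i log_part_v i * mass i Z
  - \sum_e log_part_e e * \sum_z edge_block Z e z.
Proof.
have lnv i x : mv (logm init) i x = - (eta * mv C i x) - log_part_v i.
  by rewrite -[LHS]/(ln (softmax _ x)) ln_softmax ?card_ord ?(d_gt0 i).
have lne e z : edge_block (logm init) e z
    = - (eta * edge_block C e z) - log_part_e e.
  rewrite -[LHS]/(ln (edge_block init e z)) emp_init_edge_block ln_softmax //.
  by rewrite card_prod card_ord muln_gt0 (d_gt0 (src e)).
rewrite !inner_blocks mulrDr opprD -[RHS]addrA [RHS]addrACA.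
under eq_bigr do under eq_bigr do rewrite lnv.
under [X in _ + X = _]eq_bigr do under eq_bigr do rewrite lne.
rewrite !mulr_sumr -!sumrN -!big_split /=.
congr (_ + _); apply: eq_bigr => t _; rewrite !mulr_sumr -!sumrN -big_split /=;
  by apply: eq_bigr => x _; ring.
Qed.

Lemma emp_state_init : emp_state init.
Proof.
split=> [|D kerD]; first exact: emp_init_pos_dist_blocks.
have mass0 i : mass i D = 0 := in_ker_mass i kerD.
rewrite inner_logm_init big1 => [|i _]; last by rewrite mass0 mulr0.
rewrite subr0 big1 ?subr0 // => e _.
by rewrite (sum_edge_block (in_ker_edge_marg true e kerD)) mass0 mulr0.
Qed.

Lemma S_quant_blocks : S_quant C eta =
  \sum_e (log_part_e e + \sum_z eta * edge_block C e z * uniform_dist R z)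
  + \sum_i (log_part_v i + \sum_x eta * mv C i x * uniform_dist R x).
Proof.
congr (_ + _); apply: eq_bigr => t _; congr (_ + _).
- by rewrite pair_bigA.
- rewrite pair_bigA; apply: eq_bigr => z _.
  by rewrite /uniform_dist /edge_block card_prod card_ord natrM expr2; ring.
- by apply: eq_bigr => x _; rewrite /uniform_dist card_ord; ring.
Qed.

Lemma potential_init : potential init = S_quant C eta.
Proof.
rewrite /potential inner_logm_init S_quant_blocks !big_split /=.
under eq_bigr do rewrite mass_uniform mulr1.
under [X in _ - X]eq_bigr => e _.
  rewrite (sum_edge_block (edge_marg_uniform true e)) mass_uniform mulr1; over.
have -> : eta * inner C uniform
    = \sum_i \sum_x eta * mv C i x * uniform_dist R x
    + \sum_e \sum_z eta * edge_block C e z * uniform_dist R z.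
  rewrite inner_blocks mulrDr !mulr_sumr; congr (_ + _); apply: eq_bigr => t _;
    by rewrite mulr_sumr; apply: eq_bigr => z _; rewrite mulrA.
ring.
Qed.

Lemma S_quant_le_norm1_init : S_quant C eta <= norm1_init C eta.
Proof.
have sqr_inv_le (i : 'I_n) : d%:R^-1 ^+ 2 <= d%:R^-1 :> R.
  by rewrite expr2 ler_piMr ?invr_ge0 // invf_le1 ?ltr0n ?ler1n (d_gt0 i).
rewrite S_quant_blocks addrC; apply: lerD; apply: ler_sum => t _.
  apply: log_partition_uniform_le; rewrite card_ord ?(d_gt0 t) //.
  by rewrite sqr_inv_le ?lexx.
rewrite [leRHS]pair_bigA.
apply: (log_partition_uniform_le (fun z => eta * edge_block C t z)).
  by rewrite card_prod card_ord muln_gt0 (d_gt0 (src t)).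
by rewrite card_prod card_ord natrM invfM -expr2 lexx (sqr_inv_le (src t)).
Qed.

Lemma S0_potential : S0 C eta = potential init.
Proof. by rewrite potential_init; apply/min_idPr/S_quant_le_norm1_init. Qed.

Lemma potential_step_le b G e :
  pos_dist_blocks G -> potential (step b G e) <= potential G.
Proof. by move=> dG; rewrite potential_step // gerBl gain_ge0. Qed.

Implicit Types (s t : bool * 'I_m) (ss : seq (bool * 'I_m)).

Definition run_steps ss G := foldl (fun G s => step s.1 G s.2) G ss.

Lemma run_steps_emp_state ss G : emp_state G -> emp_state (run_steps ss G).
Proof. by elim: ss G => //= s ss IHss G stG; apply/IHss/emp_state_step. Qed.

Lemma potential_run_steps_le ss G :
  pos_dist_blocks G -> potential (run_steps ss G) <= potential G.
Proof.
elim: ss G => //= s ss IHss G dG.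
apply: le_trans (IHss _ _) (potential_step_le s.1 s.2 dG).
exact: step_pos_dist_blocks.
Qed.

(* The step [t] may change a distribution compared by the violation at [s]. *)
Definition touches s t :=
  (t.2 == s.2) || (endpoint t.1 t.2 == endpoint s.1 s.2).

Lemma viol_step_untouched s t G : ~~ touches s t ->
  viol s.1 (step t.1 G t.2) s.2 = viol s.1 G s.2.
Proof.
rewrite negb_or => /andP[edge_neq end_neq].
rewrite /viol /edge_marg step_edge_block_other 1?eq_sym //.
by rewrite step_mv_other 1?eq_sym.
Qed.

Hypothesis no_loop : forall e, src e != dst e.

Lemma viol_step_touched s t G : pos_dist_blocks G -> touches s t -> t != s ->
  viol s.1 G s.2
  <= 2 * Num.sqrt (gain t.1 G t.2) + viol s.1 (step t.1 G t.2) s.2.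
Proof.
case: s t => [b e] [c f] /= dG; have [dv de] := dG.
have [->{f} _|fe] := eqVneq f e; rewrite /touches /=.
  rewrite xpair_eqE eqxx andbT => cb.
  have ends_neq : endpoint b e != endpoint c e.
    by case: b c cb => [] [] //= _; rewrite ?no_loop // eq_sym no_loop.
  rewrite /viol [mv (step _ _ _) _]step_mv_other //.
  apply: le_trans (l1_dist_triangle (edge_marg b (step c G e) e) _ _) _.
  rewrite lerD2r; apply: le_trans (l1_dist_marginal_le _ _ _) _.
  rewrite step_edge_block; apply: l1_dist_matched_joint_le_gain => //.
  exact: side_surj.
rewrite (negbTE fe) /= => /eqP ends_eq _.
rewrite /viol {2}/edge_marg step_edge_block_other 1?eq_sym //.
rewrite -/(edge_marg b G e).
apply: le_trans (l1_dist_triangle (mv (step c G f) (endpoint b e)) _ _) _.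
rewrite addrC lerD2r -ends_eq l1_distC step_mv_endpoint.
by apply: l1_dist_matched_marginal_le_gain => //; apply: side_surj.
Qed.

Lemma viol_run_steps_le s ss G : pos_dist_blocks G -> s \in ss ->
  viol s.1 G s.2 <= 2 * Num.sqrt ((count (touches s) ss)%:R
                                  * (potential G - potential (run_steps ss G))).
Proof.
elim: ss G => // t ss IHss G dG; rewrite inE /= => s_in.
set G1 := step t.1 G t.2.
have dG1 : pos_dist_blocks G1 by apply: step_pos_dist_blocks.
have le_end := potential_run_steps_le ss dG1.
have gainE : gain t.1 G t.2 = potential G - potential G1.
  by rewrite potential_step //; ring.
have gain_pos := gain_ge0 src dst t.1 t.2 dG.
have [ts|ts] := eqVneq t s.
  apply: le_trans (viol_le_gain src dst s.1 s.2 dG) _.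
  rewrite ler_wpM2l // ler_wsqrtr // -ts /touches !eqxx natrD mulrDl mul1r.
  rewrite ler_wpDr ?mulr_ge0 ?subr_ge0 //; last by rewrite gainE lerD2l lerN2.
  exact: le_trans le_end (potential_step_le _ _ dG).
rewrite eq_sym (negbTE ts) /= in s_in; have {}IHss := IHss G1 dG1 s_in.
have [tch|untch] := boolP (touches s t); last first.
  rewrite -(viol_step_untouched G untch); apply: le_trans IHss _.
  rewrite ler_wpM2l // ler_wsqrtr // ler_wpM2l // lerD2r.
  exact: potential_step_le.
apply: le_trans (viol_step_touched dG tch ts) _.
set drop := potential G1 - potential (run_steps ss G1) in IHss.
set k : R := (count _ _)%:R in IHss.
apply: (@le_trans _ _ (2 * (Num.sqrt (gain t.1 G t.2) + Num.sqrt (k * drop)))).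
  by rewrite mulrDr lerD2l.
rewrite ler_wpM2l //; apply: le_trans (sqrt_add_sqrt_mul_le _ _ _) _;
  rewrite ?subr_ge0 //.
by rewrite [X in _ * X]addrA gainE subrK natrD [1 + _]addrC.
Qed.

Definition sweep := flatten [seq [:: (false, e); (true, e)] | e <- enum 'I_m].

Lemma cyclic_iterationE G : cyclic_iteration src dst G = run_steps sweep G.
Proof.
rewrite /cyclic_iteration /sweep.
by elim: (enum 'I_m) G => //= e es IHes G; apply: IHes.
Qed.

Lemma cyclic_iteration_emp_state G :
  emp_state G -> emp_state (cyclic_iteration src dst G).
Proof. by rewrite cyclic_iterationE; apply: run_steps_emp_state. Qed.

Lemma mem_sweep s : s \in sweep.
Proof.
case: s => b e; apply/flattenP; exists [:: (false, e); (true, e)].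
  by apply/mapP; exists e; rewrite ?mem_enum.
by case: b; rewrite !inE eqxx ?orbT.
Qed.

Lemma degE i : deg src dst i = (\sum_e ((src e == i) || (dst e == i)))%N.
Proof.
rewrite /deg -sum1_card big_mkcond /=; apply: eq_bigr => e _.
rewrite (_ : (e \in _) = (src e == i) || (dst e == i)); first by case: ifP.
by apply/idP/idP; rewrite in_setE.
Qed.

Lemma count_touches_sweep s :
  count (touches s) sweep = (deg src dst (endpoint s.1 s.2)).+1.
Proof.
case: s => b e; set i := endpoint b e.
have touchesE f : count (touches (b, e)) [:: (false, f); (true, f)]
    = (((src f == i) || (dst f == i)) + (f == e))%N.
  rewrite /= /touches /= -/i; have [->|fe] /= := eqVneq f e.
    by rewrite /i; case: (b); rewrite /= eqxx ?orbT.
  by case: (eqVneq (src f) i) => // fi; rewrite -fi eq_sym (negbTE (no_loop f)).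
rewrite /sweep count_flatten sumnE !big_map -enumT big_enum.
under eq_bigr do rewrite touchesE.
rewrite big_split /= -degE (bigD1 e) //= eqxx big1 ?addn0 ?addn1 // => f.
by move/negbTE ->.
Qed.

Lemma viol_cyclic_le b G e : pos_dist_blocks G ->
  viol b G e <= 2 * Num.sqrt (((maxdeg src dst)%:R + 1)
                  * (potential G - potential (cyclic_iteration src dst G))).
Proof.
move=> dG; apply: le_trans (viol_run_steps_le dG (mem_sweep (b, e))) _.
rewrite cyclic_iterationE ler_wpM2l // ler_wsqrtr //.
rewrite ler_wpM2r ?subr_ge0 ?potential_run_steps_le //.
by rewrite count_touches_sweep natr1 ler_nat ltnS leq_bigmax.
Qed.

Lemma cyclic_iteration_decrease (eps : R) G :
  0 < eps -> pos_dist_blocks G -> ~ stopped src dst eps G ->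
  potential (cyclic_iteration src dst G)
    + eps ^+ 2 / (4 * ((maxdeg src dst)%:R + 1)) <= potential G.
Proof.
move=> eps_gt0 dG /not_stopped_viol[b [e le_viol]].
have deg_gt0 : 0 < (maxdeg src dst)%:R + 1 :> R by rewrite ltr_wpDl.
have drop_ge0 : 0 <= potential G - potential (cyclic_iteration src dst G).
  by rewrite subr_ge0 cyclic_iterationE potential_run_steps_le.
have := le_trans le_viol (viol_cyclic_le b e dG).
rewrite le_mul2_sqrt ?(ltW eps_gt0) ?mulr_ge0 ?(ltW deg_gt0) // => le_sqr.
by rewrite addrC -lerBrDr ler_pdivrMr ?mulr_gt0 // mulrC -mulrA.
Qed.

Lemma step_decrease (eps : R) b G e :
  0 < eps -> pos_dist_blocks G -> eps <= viol b G e ->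
  potential (step b G e) + eps ^+ 2 / 4 <= potential G.
Proof.
move=> eps_gt0 dG le_viol; rewrite potential_step //.
have := le_trans le_viol (viol_le_gain src dst b e dG).
rewrite le_mul2_sqrt ?(ltW eps_gt0) ?gain_ge0 //; lra.
Qed.

Lemma greedy_iteration_step (eps : R) G G' :
  greedy_iteration src dst G G' -> ~ stopped src dst eps G ->
  exists b e, eps <= viol b G e /\ G' = step b G e.
Proof.
move=> [e [b [max_viol ->]]] /not_stopped_viol[c [f le_viol]].
exists b, e; split=> //; apply: le_trans le_viol _.
have := max_viol f; rewrite ge_max !(viol_leftE src dst) !(viol_rightE src dst).
rewrite (_ : (if b then _ else _) = viol b G e); last by case: b {max_viol}.
by case: c => /andP[].
Qed.

End Trajectories.

Section LocalPolytope.
Variables (R : realType) (n d m : nat) (src dst : 'I_m -> 'I_n).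
Local Notation marg := (marg R n d m).
Local Notation in_L2 := (@in_L2 R n d m src dst).
Local Notation is_vertex := (@is_vertex R n d m src dst).
Local Notation opt_vertex := (opt_vertex src dst).
Local Notation unique_opt_vertex := (unique_opt_vertex src dst).
Local Notation Delta := (Delta src dst).
Local Notation integral := Defs.integral.
Local Notation endpoint := (endpoint src dst).
Local Notation entry := (@entry R n d m).
Local Notation constraint := (@constraint R n d m src dst).
Local Notation rhs := (@constraint_rhs R n d m).
Implicit Types C D G V W : marg.

Lemma in_L2P G : in_L2 G <-> polyhedron entry constraint rhs G.
Proof.
split=> [[Gv [Ge [Gs [Gr Gc]]]]|[G_ge0 GE]].
  split=> [[[i x]|[e z]]|[i|[[[] e] x]]]; [exact: Gv|exact: Ge|exact: Gs| |].
    by rewrite /constraint /slack edge_marg_colsum Gc subrr.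
  by rewrite /constraint /slack edge_marg_rowsum Gr subrr.
split=> [i x|]; first exact: (G_ge0 (inl (i, x))).
split=> [e x y|]; first exact: (G_ge0 (inr (e, (x, y)))).
split=> [i|]; first exact: (GE (inl i)).
split=> e x; apply/eqP; rewrite -subr_eq0; apply/eqP.
  by rewrite -edge_marg_rowsum; apply: (GE (inr (false, e, x))).
by rewrite -edge_marg_colsum; apply: (GE (inr (true, e, x))).
Qed.

Lemma in_L2E : in_L2 = polyhedron entry constraint rhs.
Proof. by apply/funext => G; apply/propext/in_L2P. Qed.

Lemma is_vertexE : is_vertex = extreme_point in_L2.
Proof. by []. Qed.

Lemma in_L2_edge_marg b e G : in_L2 G -> edge_marg b G e = mv G (endpoint b e).
Proof.
rewrite in_L2E => -[_ GE]; apply/funext => x; apply/eqP; rewrite -subr_eq0.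
exact/eqP/(GE (inr (b, e, x))).
Qed.

Lemma in_L2_dist_blocks G : in_L2 G -> dist_blocks G.
Proof.
move=> L2G; have [Gv [Ge [Gs _]]] := L2G; split=> [i|e]; split=> //.
  by move=> z; apply: Ge.
exact: etrans (sum_edge_block (in_L2_edge_marg true e L2G)) (Gs _).
Qed.

Lemma tight_states_gt0 C : tight src dst C -> 'I_n -> (0 < d)%N.
Proof.
move=> [V [[/in_L2_dist_blocks[dv _] _] _]] i.
by have := is_dist_card_gt0 (dv i); rewrite card_ord.
Qed.

Lemma L2_no_recession D :
  in_ker constraint D -> (forall k, 0 <= entry k D) -> D = 0.
Proof.
move=> kerD D_ge0; have mv0 i x : mv D i x = 0.
  apply: (psumr_eq0P _ (in_ker_mass i kerD)) => // y _.
  exact: (D_ge0 (inl (i, y))).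
apply: marg_ext => // e x y.
have := congr1 (@^~ x) (in_ker_edge_marg false e kerD).
rewrite /= mv0 edge_marg_rowsum => /psumr_eq0P -> // z _.
exact: (D_ge0 (inr (e, (x, z)))).
Qed.

Definition nonopt_vertex C V := is_vertex V /\ ~ opt_vertex C V.

Lemma opt_lt_nonopt C V W :
  opt_vertex C V -> nonopt_vertex C W -> inner C V < inner C W.
Proof.
move=> [_ [_ minV]] [vW nW]; have [L2W _] := vW.
rewrite lt_neqAle minV // andbT.
apply/eqP => eqVW; apply: nW; split=> //; split=> // Z L2Z.
by rewrite -eqVW minV.
Qed.

Lemma Delta_le_gap C V W : opt_vertex C V -> nonopt_vertex C W ->
  Delta C <= inner C W - inner C V.
Proof.
move=> oV nW; apply: ge_inf; last by exists W, V; case: nW.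
exists 0 => r [V1 [V2 [v1 [n1 [oV2 ->]]]]].
by rewrite subr_ge0 ltW // opt_lt_nonopt.
Qed.

Lemma Delta_gt0 C V W : opt_vertex C V -> nonopt_vertex C W -> 0 < Delta C.
Proof.
move=> oV nW.
have [s s_gt0 s_le] := extreme_point_gap rhs L2_no_recession (inner C).
apply: lt_le_trans s_gt0 _; apply: lb_le_inf.
  by exists (inner C W - inner C V); exists W, V; case: nW.
move=> r [V1 [V2 [v1 [n1 [oV2 ->]]]]]; apply: s_le.
- by case: oV2 => +; rewrite is_vertexE in_L2E.
- by move: v1; rewrite is_vertexE in_L2E.
- exact: opt_lt_nonopt.
Qed.

Lemma Delta_mul_deficit_le C V G i a : unique_opt_vertex C -> opt_vertex C V ->
  0 <= Delta C -> mv V i a = 1 -> in_L2 G ->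
  Delta C * (1 - mv G i a) <= inner C G - inner C V.
Proof.
move=> [V0 [_ uniq]] oV Delta_ge0 Va L2G.
apply: (gap_mul_deficit_le L2_no_recession
  (f := inner C) (g := entry (inl (i, a))) Delta_ge0 _ Va).
  move=> W extW WV; have vW : is_vertex W.
    by rewrite is_vertexE in_L2E; exact: extW.
  have nW : nonopt_vertex C W.
    split=> // /uniq WV0; case/eqP: WV; rewrite WV0; exact/esym/uniq.
  split; first by rewrite addrC -lerBrDr Delta_le_gap.
  by case: vW => -[W_ge0 _] _; apply: W_ge0.
by move: L2G; rewrite in_L2E.
Qed.

Definition assignment (x : 'I_n -> 'I_d) : marg :=
  Marg (fun i a => (a == x i)%:R)
       (fun e a c => (a == x (src e))%:R * (c == x (dst e))%:R).

Lemma assignment_in_L2 x : in_L2 (assignment x).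
Proof.
have sum1 (a : 'I_d) : \sum_c (c == a)%:R = 1 :> R.
  apply: etrans (sum_mul_pred1 a (fun=> 1)).
  by apply: eq_bigr => c _; rewrite mul1r.
split=> [i a|]; first exact: ler0n.
split=> [e a c|]; first by rewrite mulr_ge0.
split=> [i|]; first exact: sum1.
split=> e a; rewrite /rowsum /colsum /= -?mulr_sumr -?mulr_suml sum1.
  exact: mulr1.
exact: mul1r.
Qed.

Lemma assignment_inj : injective assignment.
Proof.
move=> x y xy; apply/funext => i; apply/eqP.
have := congr1 (fun G => mv G i (x i)) xy; rewrite /= eqxx.
by case: eqP => // _ /eqP; rewrite oner_eq0.
Qed.

Lemma assignment_integral x : integral (assignment x).
Proof. by split=> * /=; rewrite ?rpredM ?natr_int. Qed.

Lemma inner_assignment C x :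
  inner C (assignment x) = - map_objective src dst C x.
Proof.
rewrite /inner /map_objective opprD -!sumrN.
congr (_ + _); apply: eq_bigr => t _ /=.
  by rewrite sum_mul_pred1 opprK.
under eq_bigr do under eq_bigr do rewrite mulrA.
by under eq_bigr do rewrite sum_mul_pred1; rewrite sum_mul_pred1 opprK.
Qed.

Lemma integral_vertex G : in_L2 G -> integral G -> is_vertex G.
Proof.
move=> L2G [intv inte]; split=> // A B t L2A L2B /andP[t_gt0 t_lt1] GE.
apply: entry_inj => k.
have GkE : entry k G = t * entry k A + (1 - t) * entry k B.
  by rewrite GE; case: (k) => [[i a]|[e z]].
have entry01 Z : in_L2 Z -> 0 <= entry k Z <= 1.
  move=> /in_L2_dist_blocks dZ.
  by rewrite dist_blocks_entry_ge0 ?dist_blocks_entry_le1.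
have int_Gk : entry k G \is a Num.int.
  by case: (k) => [[i a]|[e z]]; [apply: intv|apply: inte].
have /andP[A_ge0 A_le1] := entry01 A L2A.
have /andP[B_ge0 B_le1] := entry01 B L2B.
by case: (int_num01 int_Gk (entry01 G L2G)) => Gk; rewrite Gk in GkE; nra.
Qed.

Lemma integral_assignment G :
  in_L2 G -> integral G -> exists x, G = assignment x.
Proof.
move=> L2G [intv inte]; have [dv de] := in_L2_dist_blocks L2G.
have [x xE] := choice (fun i => is_dist_integral_point_mass (dv i) (intv i)).
exists x; apply: marg_ext => [i a|e a c] /=; first exact: xE.
have [z zE] := is_dist_integral_point_mass (de e) (fun z => inte e z.1 z.2).
have side_z b : side b z = x (endpoint b e).
  have := le_marginal (side b) z (de e).1.
  rewrite -/(edge_marg b G e) (in_L2_edge_marg b e L2G) xE zE eqxx.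
  by case: eqP => // _; rewrite ler10.
rewrite -[LHS]/(edge_block G e (a, c)) zE -(side_z false) -(side_z true) /=.
by rewrite [z]surjective_pairing xpair_eqE -natrM mulnb.
Qed.

End LocalPolytope.

Section Repair.
Variables (R : realType) (n d m : nat) (src dst : 'I_m -> 'I_n).
Variables (C : marg R n d m) (eta eps : R).
Local Notation marg := (marg R n d m).
Local Notation in_L2 := (@in_L2 R n d m src dst).
Local Notation endpoint := (endpoint src dst).
Local Notation constraint := (@constraint R n d m src dst).
Local Notation slack := (@slack R n d m src dst).
Local Notation stopped := (stopped src dst eps).
Implicit Types A B D G V Z : marg.

Lemma slack_mix (t : R) A B b e x :
  slack b e x ((1 - t) *: A + t *: B)
  = (1 - t) * slack b e x A + t * slack b e x B.
Proof.
by rewrite -[slack b e x]/(constraint (inr (b, e, x))) linearD !linearZ.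
Qed.

Lemma dist_blocks_in_L2 Z :
  dist_blocks Z -> (forall b e x, slack b e x Z = 0) -> in_L2 Z.
Proof.
move=> dZ slackZ; apply/in_L2P; split=> [k|[i|[[b e] x]]].
- exact: dist_blocks_entry_ge0.
- exact: (dZ.1 i).2.
- exact: slackZ.
Qed.

Lemma in_ker_constraintB A B : dist_blocks A -> dist_blocks B ->
  (forall b e x, slack b e x A = slack b e x B) -> in_ker constraint (A - B).
Proof.
move=> dA dB slackAB [i|[[b e] x]]; rewrite linearB /=; last first.
  by rewrite slackAB subrr.
by rewrite /mass (dA.1 i).2 (dB.1 i).2 subrr.
Qed.

Lemma sum_slack G b e : dist_blocks G -> \sum_x slack b e x G = 0.
Proof.
move=> [dv de].
by rewrite sumrB sum_marginal (de e).2 (dv (endpoint b e)).2 subrr.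
Qed.

Lemma normr_slack_le G b e x : stopped G -> `|slack b e x G| <= eps.
Proof.
move=> /stoppedP/(_ b e)/ltW; apply: le_trans.
by rewrite /viol /l1_dist (bigD1 x) //= lerDl sumr_ge0.
Qed.

Definition tilt (c : R) G b e x := d%:R^-1 + c * slack b e x G.

Lemma tilt_is_dist c G b e :
  dist_blocks G -> stopped G -> `|c| * eps <= d%:R^-1 ->
  is_dist (tilt c G b e).
Proof.
move=> dG stG c_le; split=> [x|].
  have : `|c * slack b e x G| <= d%:R^-1.
    apply: le_trans c_le.
    by rewrite normrM ler_wpM2l // normr_slack_le.
  by rewrite ler_norml /tilt => /andP[]; lra.
rewrite big_split /= -mulr_sumr sum_slack // mulr0 addr0.
have := (@uniform_pos_dist R 'I_d (is_dist_card_gt0 (dG.1 (src e)))).2.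
by rewrite /uniform_dist card_ord.
Qed.

(* The product coupling has the two tilted distributions as edge marginals, so
   the slack of the corrector is [c] times that of [G]. *)
Definition corrector (c : R) G : marg :=
  Marg (fun _ _ => d%:R^-1)
       (fun e x y => tilt c G false e x * tilt c G true e y).

Lemma corrector_dist_blocks c G :
  dist_blocks G -> stopped G -> `|c| * eps <= d%:R^-1 ->
  dist_blocks (corrector c G).
Proof.
move=> dG stG c_le; split=> [i|e]; last first.
  by apply: is_dist_prod; apply: tilt_is_dist.
have := pos_dist_is_dist (@uniform_pos_dist R 'I_d (is_dist_card_gt0 (dG.1 i))).
by rewrite /uniform_dist card_ord.
Qed.

Lemma slack_corrector c G b e x :
  dist_blocks G -> stopped G -> `|c| * eps <= d%:R^-1 ->
  slack b e x (corrector c G) = c * slack b e x G.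
Proof.
move=> dG stG c_le; have sum1 b' := (tilt_is_dist b' e dG stG c_le).2.
rewrite -[LHS]/(edge_marg b (corrector c G) e x - d%:R^-1).
suff -> : edge_marg b (corrector c G) e x = tilt c G b e x.
  by rewrite /tilt addrC addKr.
case: b; first by rewrite edge_marg_colsum /colsum /= -mulr_suml sum1 mul1r.
by rewrite edge_marg_rowsum /rowsum /= -mulr_sumr sum1 mulr1.
Qed.

Lemma gibbs_cost_le G V : emp_state src dst C eta G -> dist_blocks V ->
  (forall b e x, slack b e x V = slack b e x G) ->
  eta * (inner C G - inner C V) <= (n%:R + 2 * m%:R) * ln d%:R.
Proof.
move=> [dG gibbsG] dV slackV; have dG' := pos_dist_blocks_dist dG.
have := gibbsG _ (in_ker_constraintB dV dG' slackV).
rewrite !linearB /= => gibbsVG.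
have logV := inner_logm_le0 dG' (fun k => dist_blocks_entry_ge0 k dV).
have := marg_entropy_le dG; move: gibbsVG logV; lra.
Qed.

Hypotheses (eps_gt0 : 0 < eps) (d_gt0 : (0 < d)%N) (eps_le : d%:R * eps <= 1).

Local Notation tau := (d%:R * eps).

Let tau_gt0 : 0 < tau.
Proof. by rewrite mulr_gt0 // ltr0n. Qed.
Let tau01 : 0 <= tau <= 1.
Proof. by rewrite ltW. Qed.
Let tauV_eps : tau^-1 * eps = d%:R^-1.
Proof. by field; rewrite !gt_eqF // ltr0n. Qed.

Definition repair G :=
  (1 - tau) *: G + tau *: corrector (- ((1 - tau) / tau)) G.
Definition impose_slack V G := (1 - tau) *: V + tau *: corrector tau^-1 G.

Let normr_repair_eps : `|- ((1 - tau) / tau)| * eps <= d%:R^-1.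
Proof.
have /andP[tau_ge0 tau_le1] := tau01.
rewrite normrN ger0_norm ?divr_ge0 ?subr_ge0 //.
by rewrite -mulrA tauV_eps ler_piMl ?invr_ge0 // gerBl.
Qed.

Let normr_impose_slack_eps : `|tau^-1| * eps <= d%:R^-1.
Proof. by rewrite gtr0_norm ?invr_gt0 // tauV_eps. Qed.

Lemma repair_in_L2 G : dist_blocks G -> stopped G -> in_L2 (repair G).
Proof.
move=> dG stG; apply: dist_blocks_in_L2 => [|b e x].
  by apply: dist_blocks_mix => //; apply: corrector_dist_blocks.
by rewrite slack_mix slack_corrector //; field; rewrite !gt_eqF ?ltr0n.
Qed.

Lemma repair_mv_le G i a :
  dist_blocks G -> mv (repair G) i a <= mv G i a + tau.
Proof.
move=> dG.
rewrite -[mv (repair G) i a]/((1 - tau) * mv G i a + tau * d%:R^-1).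
have tau_d : tau * d%:R^-1 <= tau.
  by rewrite ler_piMr ?(ltW tau_gt0) // invf_le1 ?ltr0n ?ler1n.
have := mulr_ge0 (ltW tau_gt0) ((dG.1 i).1 a); lra.
Qed.

Lemma impose_slack_dist_blocks V G :
  dist_blocks V -> dist_blocks G -> stopped G ->
  dist_blocks (impose_slack V G).
Proof.
move=> dV dG stG; apply: dist_blocks_mix => //; exact: corrector_dist_blocks.
Qed.

Lemma slack_impose_slack V G b e x : in_L2 V -> dist_blocks G -> stopped G ->
  slack b e x (impose_slack V G) = slack b e x G.
Proof.
move=> /in_L2P[_ /(_ (inr (b, e, x)))] /= slackV dG stG.
by rewrite slack_mix slack_corrector // slackV; field; rewrite !gt_eqF ?ltr0n.
Qed.

(* [G] minimises the entropic objective among the vectors with its own slack, so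
   it competes with [impose_slack V G], while [repair G] is a nearby point of
   the polytope. *)
Lemma repair_cost_le G V :
  0 <= eta -> emp_state src dst C eta G -> stopped G -> in_L2 V ->
  eta * (inner C (repair G) - inner C V) <=
  (n%:R + 2 * m%:R) * ln d%:R
  + 4 * (eta * normInf C * tau) * (n%:R + m%:R).
Proof.
move=> eta_ge0 stateG stG L2V; have dG := pos_dist_blocks_dist stateG.1.
have dV := in_L2_dist_blocks L2V.
have cost_G := gibbs_cost_le stateG (impose_slack_dist_blocks dV dG stG)
  (fun b e x => slack_impose_slack b e x L2V dG stG).
have move_V := normr_inner_mix_sub_le C (ltW tau_gt0) dV
  (corrector_dist_blocks dG stG normr_impose_slack_eps).
have move_G := normr_inner_mix_sub_le C (ltW tau_gt0) dG
  (corrector_dist_blocks dG stG normr_repair_eps).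
have := ler_wpM2l eta_ge0 (le_trans (ler_norm _) move_V).
have := ler_wpM2l eta_ge0 (le_trans (ler_norm _) move_G).
move: cost_G; rewrite -/(impose_slack V G) -/(repair G); lra.
Qed.

End Repair.

Section SimpleGraph.
Variables (n m : nat) (src dst : 'I_m -> 'I_n).
Hypothesis simple : simple_graph src dst.

Lemma edges_gt0 : 'I_n -> (0 < m)%N.
Proof.
move=> i; have [_ [_ /(_ i)[e _]]] := simple.
exact: leq_ltn_trans (leq0n _) (ltn_ord e).
Qed.

Lemma vertices_le_double_edges : (n <= 2 * m)%N.
Proof.
have [_ [_ covered]] := simple.
have incident i : exists s : bool * 'I_m, endpoint src dst s.1 s.2 = i.
  by have [e [ei|ei]] := covered i; [exists (false, e)|exists (true, e)].
have [f fE] := choice incident.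
have inj_f : injective f.
  by move=> i j /(congr1 (fun s => endpoint src dst s.1 s.2)); rewrite !fE.
by have := leq_card f inj_f; rewrite card_prod card_bool !card_ord.
Qed.

Lemma maxdeg_gt0 : 'I_n -> (0 < maxdeg src dst)%N.
Proof.
move=> i; have [_ [_ /(_ i)[e ei]]] := simple; apply: leq_trans (leq_bigmax i).
rewrite degE (bigD1 e) //= (_ : _ || _); first by rewrite addSn.
by apply/orP; case: ei => ->; [left|right].
Qed.

End SimpleGraph.

Section Guarantee.
Variables (R : realType) (n d m : nat) (src dst : 'I_m -> 'I_n).
Variables (C : marg R n d m) (eta eps : R).
Implicit Types G V : marg R n d m.
Local Notation Delta := (Delta src dst C).
Local Notation degree := (maxdeg src dst).
Local Notation emp_state := (emp_state src dst C eta).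
Local Notation stopped := (stopped src dst eps).
Hypothesis simple : simple_graph src dst.
Hypothesis eta_large :
  eta >= (2 * ln (16 * n%:R ^+ 2 * d%:R ^+ 2) + 16 * m%:R * d%:R ^+ 2)
           / Num.min Delta (1 / 128).
Hypothesis eps_small :
  eps^-1 > (25 * d%:R * degree%:R * m%:R) ^+ 2
           * Num.max (eta * normInf C) 68.

Lemma eps_gt0 : 0 < eps.
Proof.
rewrite -invr_gt0; apply: le_lt_trans eps_small.
by rewrite mulr_ge0 ?sqr_ge0 // le_max ler0n orbT.
Qed.

Section Estimates.
Hypotheses (n_gt0 : (0 < n)%N) (d_gt0 : (0 < d)%N).

Let vertex0 : 'I_n := Ordinal n_gt0.
Let d_ge1 : 1 <= d%:R :> R. Proof. by rewrite ler1n. Qed.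
Let m_ge1 : 1 <= m%:R :> R.
Proof. by rewrite ler1n (edges_gt0 simple vertex0). Qed.
Let degree_ge1 : 1 <= degree%:R :> R.
Proof. by rewrite ler1n (maxdeg_gt0 simple vertex0). Qed.
Let n_le : n%:R <= 2 * m%:R :> R.
Proof. by rewrite -natrM ler_nat (vertices_le_double_edges simple). Qed.

Let numerator_ge : 16 * (m%:R * d%:R ^+ 2) <=
  2 * ln (16 * n%:R ^+ 2 * d%:R ^+ 2) + 16 * m%:R * d%:R ^+ 2 :> R.
Proof.
rewrite mulrA lerDr mulr_ge0 // ln_ge0 // -mulrA -exprMn.
have : 1 <= n%:R * d%:R :> R by rewrite mulr_ege1 // ler1n.
by move=> /(exprn_ege1 2)/le_trans; apply; rewrite ler_peMl ?sqr_ge0 ?ler1n.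
Qed.

Lemma eta_ge0 : 0 < Delta -> 0 <= eta.
Proof.
move=> Delta_gt0; apply: le_trans eta_large; rewrite divr_ge0 //.
  by apply: le_trans numerator_ge; rewrite !mulr_ge0 ?sqr_ge0.
by rewrite le_min (ltW Delta_gt0) /=; lra.
Qed.

Lemma eta_mul_Delta_ge : 0 < Delta -> 16 * (m%:R * d%:R ^+ 2) <= eta * Delta.
Proof.
move=> Delta_gt0; have min_gt0 : 0 < Num.min Delta (1 / 128).
  by rewrite lt_min Delta_gt0; lra.
apply: (@le_trans _ _ (eta * Num.min Delta (1 / 128))).
  by apply: le_trans numerator_ge _; rewrite -ler_pdivrMr.
by rewrite ler_wpM2l ?eta_ge0 // ge_min lexx.
Qed.

Lemma mul_eps_le (x : R) : x <= Num.max (eta * normInf C) 68 ->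
  625 * (d%:R * m%:R * (x * eps)) <= 1.
Proof.
set M := Num.max _ _ => x_le; pose q : R := d%:R * degree%:R * m%:R.
have Meps_ge0 : 0 <= M * eps.
  by rewrite mulr_ge0 ?(ltW eps_gt0) // le_max ler0n orbT.
have dm_ge1 : 1 <= d%:R * m%:R :> R by rewrite mulr_ege1.
have dm_le_q : d%:R * m%:R <= q.
  by rewrite /q mulrAC ler_peMr // (le_trans ler01).
have dm_le : d%:R * m%:R <= q ^+ 2.
  apply: (le_trans dm_le_q); rewrite expr2 ler_peMr ?mulr_ge0 //.
  exact: le_trans dm_ge1 dm_le_q.
have qM_le : 625 * (q ^+ 2 * (M * eps)) <= 1.
  have -> : 625 * (q ^+ 2 * (M * eps))
      = (25 * d%:R * degree%:R * m%:R) ^+ 2 * M * eps by rewrite /q; ring.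
  by rewrite -ler_pdivlMr ?eps_gt0 // div1r (ltW eps_small).
apply: le_trans qM_le; rewrite ler_wpM2l ?ler0n //.
apply: (@le_trans _ _ (d%:R * m%:R * (M * eps))).
  by rewrite ler_wpM2l ?mulr_ge0 // ler_wpM2r // (ltW eps_gt0).
by rewrite ler_wpM2r.
Qed.

Lemma d_mul_eps_le : d%:R * eps <= 1 / 100.
Proof.
have /mul_eps_le : 68 <= Num.max (eta * normInf C) 68.
  by rewrite le_max lexx orbT.
have : d%:R * eps <= d%:R * eps * m%:R.
  by rewrite ler_peMr // mulr_ge0 // (ltW eps_gt0).
lra.
Qed.

Lemma cost_error_le : 0 < Delta ->
  4 * (eta * normInf C * (d%:R * eps)) * (n%:R + m%:R) <= 1 / 50.
Proof.
move=> /eta_ge0 eta_pos.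
have /mul_eps_le bound : eta * normInf C <= Num.max (eta * normInf C) 68.
  by rewrite le_max lexx.
have cost_ge0 : 0 <= 4 * (eta * normInf C * (d%:R * eps)).
  by rewrite !mulr_ge0 ?normInf_ge0 // (ltW eps_gt0).
apply: (@le_trans _ _ (4 * (eta * normInf C * (d%:R * eps)) * (3 * m%:R))).
  by rewrite ler_wpM2l //; move: n_le; lra.
by move: bound; lra.
Qed.

Lemma entropy_bound_le :
  (n%:R + 2 * m%:R) * ln d%:R <= m%:R * d%:R ^+ 2 :> R.
Proof.
have ln_le : ln d%:R <= d%:R ^+ 2 / 4 :> R.
  apply: le_trans (ln_le_subr1 _) _; first by rewrite ltr0n.
  by have := sqr_ge0 (d%:R - 2 : R); lra.
apply: (@le_trans _ _ (4 * m%:R * (d%:R ^+ 2 / 4))); last lra.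
by apply: ler_pM => //; [apply: ln_ge0|move: n_le; lra].
Qed.

End Estimates.

Hypothesis tight_C : tight src dst C.
Hypothesis unique_C : unique_opt_vertex src dst C.

Lemma stopped_mv_gt_half G V i a :
  emp_state G -> stopped G -> opt_vertex src dst C V ->
  mv V i a = 1 -> 0 < Delta -> 1 / 2 < mv G i a.
Proof.
move=> stateG stG oV Va Delta_gt0.
have n_gt0 : (0 < n)%N := leq_ltn_trans (leq0n _) (ltn_ord i).
have d_gt0 : (0 < d)%N := leq_ltn_trans (leq0n _) (ltn_ord a).
have eta_pos := eta_ge0 n_gt0 d_gt0 Delta_gt0.
have tau_le := d_mul_eps_le n_gt0 d_gt0; have tau_le1 : d%:R * eps <= 1 by lra.
have dG := pos_dist_blocks_dist stateG.1.
have L2G' := repair_in_L2 eps_gt0 d_gt0 tau_le1 dG stG.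
have L2V : in_L2 src dst V by case: oV => -[].
set G' := repair src dst eps G in L2G'; set deficit := 1 - mv G' i a.
have deficit_ge0 : 0 <= deficit.
  by rewrite subr_ge0; apply: is_dist_le1; case: (in_L2_dist_blocks L2G').
have Y_ge1 : 1 <= m%:R * d%:R ^+ 2 :> R.
  by rewrite mulr_ege1 ?exprn_ege1 ?ler1n ?(edges_gt0 simple i).
have cost_ge : 16 * (m%:R * d%:R ^+ 2) * deficit
    <= eta * (inner C G' - inner C V).
  have := eta_mul_Delta_ge n_gt0 d_gt0 Delta_gt0.
  move=> /(ler_wpM2r deficit_ge0)/le_trans; apply; rewrite -mulrA ler_wpM2l //.
  exact: Delta_mul_deficit_le unique_C oV (ltW Delta_gt0) Va L2G'.
have cost_le : eta * (inner C G' - inner C V) <= m%:R * d%:R ^+ 2 + 1 / 50.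
  have := repair_cost_le eps_gt0 d_gt0 tau_le1 eta_pos stateG stG L2V.
  move=> /le_trans; apply; apply: lerD; first exact: entropy_bound_le.
  exact: cost_error_le.
have deficit_le : deficit <= 1 / 10.
  have := le_trans cost_ge cost_le; move: Y_ge1; set Y := m%:R * _; nra.
have := repair_mv_le src dst eps_gt0 d_gt0 i a dG.
by move: deficit_le; rewrite /deficit /G'; lra.
Qed.

Lemma distinct_assignment_Delta_gt0 x y : x <> y ->
  opt_vertex src dst C (assignment R src dst y) -> 0 < Delta.
Proof.
move=> xy opt_y; apply: (Delta_gt0 opt_y (W := assignment R src dst x)); split.
  apply: integral_vertex; first exact: assignment_in_L2.
  exact: assignment_integral.
have [V [_ uniq]] := unique_C => /uniq; rewrite -(uniq _ opt_y).
by move=> /assignment_inj.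
Qed.

Lemma stopped_rounding_MAP G x :
  emp_state G -> stopped G -> is_rounding G x -> is_MAP src dst C x.
Proof.
move=> stateG stG round_x; have [V [[L2V minV] intV]] := tight_C.
have [y VE] := integral_assignment L2V intV.
have oV : opt_vertex src dst C V by split; [exact: integral_vertex|split].
suff -> : x = y.
  move=> z; have := minV _ (assignment_in_L2 R src dst z).
  by rewrite VE !inner_assignment lerN2.
apply: contrapT => xy; apply: (xy); apply/funext => i.
have Delta_gt0 : 0 < Delta.
  by apply: distinct_assignment_Delta_gt0 xy _; rewrite -VE.
apply: (is_dist_majority (pos_dist_is_dist (stateG.1.1 i)) _ (round_x i)).
by apply: stopped_mv_gt_half oV _ Delta_gt0; rewrite // VE /= eqxx.
Qed.

Lemma descent_returns_MAP traj (delta : R) :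
  0 < delta -> traj 0%N = emp_init C eta ->
  (forall t, emp_state (traj t) -> ~ stopped (traj t) ->
     emp_state (traj t.+1)
     /\ potential (traj t.+1) + delta <= potential (traj t)) ->
  returns_MAP_within src dst C eps traj (S0 C eta / delta).
Proof.
move=> delta_gt0 traj0 decr; have d_gt0 := tight_states_gt0 tight_C.
have [||t [st_t before state_t t_le]] :=
    descent_first_stop (stop := stopped) delta_gt0 _ _ decr.
- by move=> G [dG _]; apply: potential_ge0.
- by rewrite traj0; apply: emp_state_init.
exists t; split; last by do 2 split=> //; move=> x; apply: stopped_rounding_MAP.
rewrite -(ler_int R); apply: le_trans (ceil_ge _).
by rewrite ler_pdivlMr // (S0_potential src dst C eta d_gt0) -traj0.
Qed.

End Guarantee.

Theorem theorem3 (R : realType) (n d m : nat) (src dst : 'I_m -> 'I_n)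
  (C : marg R n d m) (eta eps : R) :
  simple_graph src dst ->
  eta >= (2 * ln (16 * n%:R ^+ 2 * d%:R ^+ 2) + 16 * m%:R * d%:R ^+ 2)
           / Num.min (Delta src dst C) (1 / 128) ->
  eps^-1 > (25 * d%:R * (maxdeg src dst)%:R * m%:R) ^+ 2
           * Num.max (eta * normInf C) 68 ->
  tight src dst C ->
  unique_opt_vertex src dst C ->
  returns_MAP_within src dst C eps (cyclic_traj src dst C eta)
     (4 * S0 C eta * ((maxdeg src dst)%:R + 1) / eps ^+ 2)
  /\
  (forall traj, greedy_traj src dst C eta eps traj ->
     returns_MAP_within src dst C eps traj (4 * S0 C eta / eps ^+ 2)).
Proof.
move=> simple eta_large eps_small tight_C unique_C.
have d_gt0 := tight_states_gt0 tight_C; have eps_gt0 := eps_gt0 eps_small.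
have degree_gt0 : 0 < (maxdeg src dst)%:R + 1 :> R by rewrite ltr_wpDl.
have returns := descent_returns_MAP simple eta_large eps_small tight_C unique_C.
split=> [|traj [traj0 greedy]].
  rewrite (_ : _ / _ = S0 C eta
      / (eps ^+ 2 / (4 * ((maxdeg src dst)%:R + 1)))); last first.
    by field; rewrite !gt_eqF.
  apply: returns => // [|t state_t running].
    by rewrite divr_gt0 ?mulr_gt0 ?exprn_gt0.
  split; first exact: cyclic_iteration_emp_state.
  apply: cyclic_iteration_decrease running => //; first by case: simple.
  by case: state_t.
rewrite (_ : _ / _ = S0 C eta / (eps ^+ 2 / 4)); last by field; rewrite gt_eqF.
apply: returns => // [|t state_t running]; first by rewrite divr_gt0 ?exprn_gt0.
have [b [e [le_viol ->]]] := greedy_iteration_step (greedy t running) running.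
by split; [apply: emp_state_step|apply: step_decrease le_viol; case: state_t].
Qed.
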